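(* Let $(E,C)$ be a finite bipartite separated graph, let $\{(E_n,C^n)\}_{n\ge 0}$ be the canonical sequence of bipartite separated graphs associated to $(E,C)$, and let $(F_\infty,D^\infty)$ be the complete multiresolution of $(E,C)$. Then: (a) For each $n\ge 0$ there is a natural isomorphism $\varphi_n\colon M(E_{n+1},C^{n+1})\to M((E_n)_{V_n},(C^n)^{V_n})$ (with $a_v\mapsto a_v$), where $V_n=E_n^{0,0}$ and $((E_n)_{V_n},(C^n)^{V_n})$ is the multiresolution of $(E_n,C^n)$ at $V_n$. (b) For each $n\ge 0$ there is a canonical unitary embedding $\iota_n\colon M(E_n,C^n)\to M(E_{n+1},C^{n+1})$, namely $\iota_n=\varphi_n^{-1}\circ M(\iota_{V_n})$, where $M(\iota_{V_n})\colon M(E_n,C^n)\to M((E_n)_{V_n},(C^n)^{V_n})$ is induced by the inclusion ($a_v\mapsto a_v$). (c) For each $n\ge 0$ the canonical inclusion $j_n\colon (E_n,C^n)\to(F_n,D^n)$ induces an isomorphism $M(j_n)\colon M(E_n,C^n)\to M(F_n,D^n)$. (d) $M(F_\infty,D^\infty)\cong\varinjlim(M(E_n,C^n),\iota_n)$. Consequently, the natural map $M(E,C)\to\varinjlim(M(E_n,C^n),\iota_n)$ is a refinement of $M(E,C)$.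
   Context: A separated graph is a pair $(E,C)$, where $E=(E^0,E^1,r,s)$ is a directed graph and $C=\bigsqcup_{v\in E^0}C_v$ with $C_v$ a partition of $r^{-1}(v)$ into nonempty subsets ($C_v=\emptyset$ if $r^{-1}(v)=\emptyset$). It is finite if $E^0,E^1$ are finite. It is bipartite if $E^0=E^{0,0}\sqcup E^{0,1}$, all arrows go from $E^{0,1}$ to $E^{0,0}$, $r(E^1)=E^{0,0}$ and $s(E^1)=E^{0,1}$. $M(E,C)$ (for all sets in $C$ finite) is the abelian monoid with generators $a_v$ ($v\in E^0$) and relations $a_v=\sum_{e\in X}a_{s(e)}$ for $v\in E^0$, $X\in C_v$. Multiresolution. For $V\subseteq E^0$ with $C_u=\{X_1^u,\dots,X_{k_u}^u\}$, all $X_i^u$ finite, for $u\in V$, the multiresolution $(E_V,C^V)$ of $(E,C)$ at $V$ is: $E_V^0=E^0\sqcup\bigsqcup_{u\in V}\{v(x_1,\dots,x_{k_u}):x_i\in X_i^u\}$ (new distinct vertices, which are sources, i.e. receive no arrows); $E_V^1$ is $E^1$ together with, for each $u\in V$, each $i$ and each $(x_1,\dots,x_{k_u})\in\prod_jX_j^u$, a new arrow $\alpha^{x_i}(x_1,\dots,\widehat{x_i},\dots,x_{k_u})$ with range $s(x_i)$ and source $v(x_1,\dots,x_{k_u})$; and for $w\in E^0$, $(C^V)_w=C_w\sqcup\{X(x_i): x_i\in X_i^u,\ s(x_i)=w,\ 1\le i\le k_u,\ u\in V\}$, where $X(x_i)=\{\alpha^{x_i}(x_1,\dots,\widehat{x_i},\dots,x_{k_u}):x_j\in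 X_j^u,\ j\ne i\}$. Canonical sequence and complete multiresolution. Set $(F_0,D^0)=(E,C)$, $F^{0,0}=E^{0,0}$, $F^{0,1}=E^{0,1}$, $F^{1,0}=E^1$. Inductively $(F_{n+1},D^{n+1})$ is the multiresolution of $(F_n,D^n)$ at $F^{0,n}$... where more precisely at step $n\to n+1$ the multiresolution is taken at the set $F^{0,n}$ of vertices which are the ranges of the arrows in the last layer $F^{1,n}$; $F^{0,n+2}$ is the set of new vertices and $F^{1,n+1}$ the set of new arrows, so $s(F^{1,n+1})=F^{0,n+2}$, $r(F^{1,n+1})=F^{0,n+1}$. Put $(F_\infty,D^\infty)=\bigcup_n(F_n,D^n)$ (the complete multiresolution). Define $E_n^{0,0}=F^{0,n}$, $E_n^{0,1}=F^{0,n+1}$, $E_n^1=F^{1,n}$, $C^n_v=D^n_v$ restricted to the arrows of $F^{1,n}$ (i.e. the partition of the arrows of $F^{1,n}$ with range $v$) for $v\in E_n^{0,0}$ and $C^n_v=\emptyset$ for $v\in E_n^{0,1}$; $(E_0,C^0)=(E,C)$. This is the canonical sequence of bipartite separated graphs. Explicitly $\iota_n(a_w)=a_w$ for $w\in E_n^{0,1}$ and $\iota_n(a_u)=\sum_{(x_1,\dots,x_{k_u})\in\prod X_i^u}a_{v(x_1,\dots,x_{k_u})}$ for $u\in E_n^{0,0}$ with $C^n_u=\{X_1^u,\dots,X^u_{k_u}\}$. On abelian monoids, $\le$ is the algebraic preorder ($x\le y$ iff $x+z=y$ for some $z$). A monoid homomorphism $\psi\colon M\to F$ is a unitary embedding if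 it is injective, $\psi(M)$ is cofinal in $F$ (each $u\in F$ satisfies $u\le\psi(v)$ for some $v\in M$), and whenever $u,u'\in M$, $v\in F$ with $\psi(u)+v=\psi(u')$, then $v\in\psi(M)$. A refinement monoid is an abelian monoid in which $a+b=c+d$ implies there are $x,y,z,t$ with $a=x+y$, $b=z+t$, $c=x+z$, $d=y+t$. A monoid is conical if $a+b=0$ implies $a=b=0$. A refinement of an abelian conical monoid $M$ is an abelian conical monoid $N$ with a homomorphism $\iota\colon M\to N$ such that: $\iota$ is a unitary embedding; $N$ is a refinement monoid; and for every refinement monoid $P$ and homomorphism $\psi\colon M\to P$ there is a homomorphism $\widetilde\psi\colon N\to P$ with $\psi=\widetilde\psi\circ\iota$. *)

(* Defs.v *)
From HB Require Import structures.
From mathcomp Require Import all_boot all_algebra.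
From mathcomp Require Import boolp classical_sets cardinality.

Set Implicit Arguments.
Unset Strict Implicit.
Unset Printing Implicit Defensive.

Import GRing.Theory.
Local Open Scope classical_set_scope.
Local Open Scope quotient_scope.
Local Open Scope ring_scope.

(* The abelian monoid <T | R>: finite words in T, up to the smallest
   congruence that contains R and makes concatenation commutative. *)
Section Presentation.
Variables (T : choiceType) (R : seq T -> seq T -> Prop).

Inductive pcong : seq T -> seq T -> Prop :=
| pcong_rel w w' : R w w' -> pcong w w'
| pcong_comm w w' : pcong (w ++ w') (w' ++ w)
| pcong_refl w : pcong w w
| pcong_sym w w' : pcong w w' -> pcong w' w
| pcong_trans w w' w'' : pcong w w' -> pcong w' w'' -> pcong w w''
| pcong_cat w w' z z' : pcong w w' -> pcong z z' -> pcong (w ++ z) (w' ++ z').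

Definition pcongb (w w' : seq T) : bool := `[< pcong w w' >].

Lemma pcongb_refl : reflexive pcongb.
Proof. by move=> w; apply/asboolP; apply: pcong_refl. Qed.

Lemma pcongb_sym : symmetric pcongb.
Proof. by move=> w w'; apply/asboolP/asboolP; apply: pcong_sym. Qed.

Lemma pcongb_trans : transitive pcongb.
Proof.
move=> w w' w'' /asboolP h /asboolP h'.
by apply/asboolP; apply: pcong_trans h h'.
Qed.

Canonical pcongb_equiv := EquivRel pcongb pcongb_refl pcongb_sym pcongb_trans.

Definition presented := {eq_quot pcongb_equiv}.
HB.instance Definition _ := Choice.on presented.

Definition pclass (w : seq T) : presented := \pi_presented w.

Lemma pclassP w w' : pclass w = pclass w' <-> pcong w w'.
Proof.
split=> [/eqP|h]; first by rewrite piE => /asboolP.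
by apply/eqP; rewrite piE; apply/asboolP.
Qed.

Definition padd (x y : presented) : presented := pclass (repr x ++ repr y).

Lemma pclass_repr x : pclass (repr x) = x.
Proof. exact: reprK. Qed.

Lemma padd_pclass w w' : padd (pclass w) (pclass w') = pclass (w ++ w').
Proof.
by apply/pclassP/pcong_cat; apply/pclassP; rewrite pclass_repr.
Qed.

Lemma paddA : associative padd.
Proof.
move=> x y z; rewrite -(pclass_repr x) -(pclass_repr y) -(pclass_repr z).
by rewrite !padd_pclass catA.
Qed.

Lemma paddC : commutative padd.
Proof. by move=> x y; apply/pclassP/pcong_comm. Qed.

Lemma padd0 : left_id (pclass [::]) padd.
Proof. by move=> x; rewrite -(pclass_repr x) padd_pclass. Qed.

HB.instance Definition _ := GRing.isNmodule.Build presented paddA paddC padd0.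

Definition pgen (t : T) : presented := pclass [:: t].

End Presentation.

Section MonoidNotions.

Definition conical (M : nmodType) := forall a b : M, a + b = 0 -> a = 0 /\ b = 0.

Definition refinement_monoid (M : nmodType) := forall a b c d : M, a + b = c + d ->
  exists x y z t, [/\ a = x + y, b = z + t, c = x + z & d = y + t].

Definition alg_le (M : nmodType) (x y : M) := exists z, x + z = y.

Definition unitary_embedding (M F : nmodType) (psi : M -> F) :=
  [/\ injective psi,
      forall u : F, exists v : M, alg_le u (psi v)
    & forall (u u' : M) (v : F), psi u + v = psi u' -> exists w : M, v = psi w].

Definition is_refinement (M N : nmodType) (iota : {additive M -> N}) :=
  [/\ conical M, conical N, unitary_embedding iota, refinement_monoid N
    & forall (P : nmodType) (psi : {additive M -> P}), refinement_monoid P ->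
        exists psit : {additive N -> P}, forall x, psi x = psit (iota x)].

End MonoidNotions.

(* The direct limit of M 0 -> M 1 -> M 2 -> ..., as the abelian monoid
   generated by the elements of all the M n, subject to the relations which
   make the maps M n -> dirlim f homomorphisms compatible with f. *)
Section DirectLimit.
Variables (M : nat -> nmodType) (f : forall n, {additive M n -> M n.+1}).

Definition lim_gen : choiceType := {n : nat & M n : choiceType}.
Definition lim_elt n (x : M n) : lim_gen := Tagged (fun n => M n : choiceType) x.

Inductive lim_rel : seq lim_gen -> seq lim_gen -> Prop :=
| lim_rel0 n : lim_rel [:: lim_elt (0 : M n)] [::]
| lim_relD n (x y : M n) : lim_rel [:: lim_elt (x + y)] [:: lim_elt x; lim_elt y]
| lim_relS n (x : M n) : lim_rel [:: lim_elt x] [:: lim_elt (f n x)].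

Definition dirlim := presented lim_rel.
Definition to_dirlim n (x : M n) : dirlim := pgen lim_rel (lim_elt x).

End DirectLimit.

(* [blk v] is the partition C_v of r^-1(v). *)
Record sepGraph := SepGraph {
  vert : choiceType;
  arr : choiceType;
  rng : arr -> vert;
  src : arr -> vert;
  blk : vert -> set (set arr);
  blkP : forall v, partition (blk v) id (rng @^-1` [set v])
}.
Arguments rng {s}.
Arguments src {s}.

Definition finite_sepGraph (G : sepGraph) :=
  finite_set [set: vert G] /\ finite_set [set: arr G].

Lemma partition_idP (T : Type) (D : set (set T)) (A : set T) :
  partition D id A <->
  [/\ forall X, D X -> X `<=` A, forall a, A a -> exists2 X, D X & X a,
      forall X Y a, D X -> D Y -> X a -> Y a -> X = Y
    & forall X, D X -> X !=set0].
Proof.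
split=> [[cov triv ne]|[sub cov triv ne]].
  split=> //.
  - by move=> X DX a Xa; rewrite -cov; exists X.
  - by move=> a; rewrite -cov => -[X DX Xa]; exists X.
  - by move=> X Y a DX DY Xa Ya; apply: triv => //; exists a.
split=> //.
- apply/seteqP; split=> [a [X DX Xa]|a Aa]; first exact: (sub X).
  by have [X DX Xa] := cov a Aa; exists X.
- by move=> X Y DX DY [a [Xa Ya]]; apply: triv DX DY Xa Ya.
Qed.

(* A word [:: v1; ...; vk] stands for a_v1 + ... + a_vk. Infinite blocks have
   no enumeration l and give no relation. *)
Inductive mon_rel (G : sepGraph) : seq (vert G) -> seq (vert G) -> Prop :=
| MonRel v (X : set (arr G)) (l : seq (arr G)) :
    blk v X -> uniq l -> X = [set` l] -> mon_rel [:: v] [seq src e | e <- l].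

Definition Mon (G : sepGraph) := presented (@mon_rel G).

Definition agen (G : sepGraph) (v : vert G) : Mon G := pgen (@mon_rel G) v.

(* h is the homomorphism M(f); homomorphisms are determined by their values on
   the generators a_v. *)
Definition induced_by (G H : sepGraph) (f : vert G -> vert H)
  (h : Mon G -> Mon H) := forall v, h (agen v) = agen (f v).

Section Multiresolution.
Variables (G : sepGraph) (W : set (vert G)).

(* The blocks X_1, ..., X_k of C_u are disjoint, so that the tuples
   (x_1, ..., x_k) in X_1 * ... * X_k are in bijection with the sets
   {x_1, ..., x_k}, i.e. the transversals of C_u. *)
Definition transversal (u : vert G) (Y : set (arr G)) :=
  Y `<=` rng @^-1` [set u] /\ forall X, blk u X -> exists! x, (X `&` Y) x.

(* (u, Y) is the vertex v(x_1, ..., x_k), where Y = {x_1, ..., x_k} *)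
Definition newVert : choiceType :=
  {p : vert G * set (arr G) | `[< W p.1 /\ transversal p.1 p.2 >]}.
Definition tup (p : newVert) : set (arr G) := (val p).2.

(* (v(x_1, ..., x_k), x_i) is the arrow alpha^{x_i}(x_1, ..., ^x_i, ..., x_k) *)
Definition newArr : choiceType := {q : newVert * arr G | `[< tup q.1 q.2 >]}.
Definition sel (q : newArr) : arr G := (val q).2.

Definition mr_vert : choiceType := (vert G + newVert)%type.
Definition mr_arr : choiceType := (arr G + newArr)%type.

Definition mr_rng (e : mr_arr) : mr_vert :=
  match e with inl e => inl (rng e) | inr q => inl (src (sel q)) end.
Definition mr_src (e : mr_arr) : mr_vert :=
  match e with inl e => inl (src e) | inr q => inr (val q).1 end.

(* X(x) *)
Definition mr_block (x : arr G) : set mr_arr := [set inr q | q in [set q | sel q = x]].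

Definition mr_blk (v : mr_vert) : set (set mr_arr) :=
  match v with
  | inl w => [set inl @` X | X in blk w] `|`
             [set mr_block x | x in [set x | W (rng x) /\ src x = w]]
  | inr _ => set0
  end.

Lemma ex_transversal (x : arr G) : exists2 Y, transversal (rng x) Y & Y x.
Proof.
have /partition_idP[sub cov triv ne] := blkP (rng x).
have /choice[c cP] : forall X, exists y,
    blk (rng x) X -> X y /\ (X x -> y = x).
  move=> X; have [Xx|nXx] := pselect (X x); first by exists x.
  have [DX|nDX] := pselect (blk (rng x) X); last by exists x.
  by have [y Xy] := ne _ DX; exists y.
exists [set c X | X in blk (rng x)]; last first.
  have [X DX Xx] := cov x erefl; exists X => //.
  by have [_ ->] := cP _ DX.
split=> [_ [X DX <-]|X DX]; first by apply: (sub X DX); have [] := cP _ DX.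
exists (c X); split=> [|y [Xy [Z DZ cZ]]].
  by have [? _] := cP _ DX; split=> //; exists X.
have [Zy _] := cP _ DZ; rewrite cZ in Zy.
by rewrite -cZ (triv X Z _ DX DZ Xy Zy).
Qed.

Lemma mr_blkP v : partition (mr_blk v) id (mr_rng @^-1` [set v]).
Proof.
apply/partition_idP; case: v => [w|p]; last first.
  by split=> //; case=> [e|q].
have /partition_idP[sub cov triv ne] := blkP w; split.
- move=> _ [[X DX <-] _ [e Xe <-]|[x [_ xw] <-] _ [q qx <-]] /=.
    by congr inl; exact: (sub X DX e Xe).
  by rewrite qx xw.
- case=> [e [/cov[X DX Xe]]|q [qw]].
    by exists (inl @` X); [left; exists X|exists e].
  exists (mr_block (sel q)); last by exists q.
  right; exists (sel q) => //; split=> //.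
  have /asboolP qY := valP q.
  have /asboolP[Wu [Yu _]] := valP (val q).1.
  by rewrite (Yu _ qY).
- move=> _ _ a [[X DX <-]|[x [_ _] <-]] [[Y DY <-]|[y [_ _] <-]].
  + move=> [e Xe <-] [e' Ye [ee]]; rewrite ee in Ye.
    by rewrite (triv X Y e).
  + by move=> [e Xe <-] [].
  + by move=> [q qx <-] [].
  + by move=> [q <- <-] [q' <- [->]].
- move=> _ [[X DX <-]|[x [Wx xw] <-]].
    by have [e Xe] := ne _ DX; exists (inl e); exists e.
  have [Y tY Yx] := ex_transversal x.
  have pP : `[< W (rng x, Y).1 /\ transversal (rng x, Y).1 (rng x, Y).2 >].
    exact/asboolP.
  pose p : newVert := exist _ (rng x, Y) pP.
  have qP : `[< tup (p, x).1 (p, x).2 >] by apply/asboolP.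
  by exists (inr (exist _ (p, x) qP)); exists (exist _ (p, x) qP).
Qed.

Definition multires : sepGraph := SepGraph mr_src mr_blkP.

End Multiresolution.

Section Restriction.
Variables (G : sepGraph) (P : set (vert G)) (Q : set (arr G)).
Hypothesis QP : forall a, Q a -> P (rng a) /\ P (src a).

Definition rs_vert : choiceType := {v : vert G | `[< P v >]}.
Definition rs_arr : choiceType := {a : arr G | `[< Q a >]}.

Lemma rs_rngP (a : rs_arr) : `[< P (rng (val a)) >].
Proof. by have /asboolP/QP[? _] := valP a; apply/asboolP. Qed.
Lemma rs_srcP (a : rs_arr) : `[< P (src (val a)) >].
Proof. by have /asboolP/QP[_ ?] := valP a; apply/asboolP. Qed.

Definition rs_rng (a : rs_arr) : rs_vert := exist _ (rng (val a)) (rs_rngP a).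
Definition rs_src (a : rs_arr) : rs_vert := exist _ (src (val a)) (rs_srcP a).

Definition rs_blk (v : rs_vert) : set (set rs_arr) :=
  [set X | X !=set0 /\ exists2 Y, blk (val v) Y & X = val @^-1` Y].

Lemma rs_blkP v : partition (rs_blk v) id (rs_rng @^-1` [set v]).
Proof.
have /partition_idP[sub cov triv ne] := blkP (val v).
apply/partition_idP; split.
- move=> X [_ [Y DY ->]] a Ya; apply: val_inj; exact: (sub Y).
- move=> a av; have [Y DY Ya] : exists2 Y, blk (val v) Y & Y (val a).
    by apply: cov; rewrite -av.
  by exists (val @^-1` Y) => //; split; [exists a|exists Y].
- move=> X X' a [_ [Y DY ->]] [_ [Z DZ ->]] Ya Za.
  by rewrite (triv Y Z (val a)).
- by move=> X [].
Qed.

Definition restrict : sepGraph := SepGraph rs_src rs_blkP.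

End Restriction.

Record bipGraph := BipGraph {
  bip_graph :> sepGraph;
  bip0 : set (vert bip_graph);  (* E^{0,0} *)
  bip1 : set (vert bip_graph);  (* E^{0,1} *)
  bip_cover : bip0 `|` bip1 = setT;
  bip_disj : bip0 `&` bip1 = set0;
  bip_rng : range (@rng bip_graph) = bip0;
  bip_src : range (@src bip_graph) = bip1
}.

(* (F_n, D^n) with its last layers *)
Record stage := Stage {
  st_graph :> sepGraph;
  lay0 : set (vert st_graph);  (* F^{0,n} *)
  lay1 : set (vert st_graph);  (* F^{0,n+1} *)
  layA : set (arr st_graph);   (* F^{1,n} *)
  lay_ends : forall a, layA a -> lay0 (rng a) /\ lay1 (src a);
  lay_full : forall a, lay0 (rng a) -> layA a;
  lay_source : forall a, ~ lay1 (rng a)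
}.

Section CompleteMultiresolution.
Variable E : bipGraph.

Lemma stage0_ends (a : arr E) : setT a -> bip0 (rng a) /\ bip1 (src a).
Proof. by move=> _; rewrite -bip_rng -bip_src; split; exists a. Qed.

Lemma stage0_source (a : arr E) : ~ bip1 (rng a).
Proof.
move=> ta; have : (@bip0 E `&` @bip1 E) (rng a).
  by split=> //; rewrite -bip_rng; exists a.
by rewrite bip_disj.
Qed.

Definition stage0 : stage :=
  @Stage E (@bip0 E) (@bip1 E) setT stage0_ends (fun _ _ => I) stage0_source.

Section NextStage.
Variable S : stage.
Let G : sepGraph := multires (@lay0 S).

Definition next_lay0 : set (vert G) := inl @` @lay1 S.
Definition next_lay1 : set (vert G) := range inr.
Definition next_layA : set (arr G) := range inr.

Lemma next_ends a : next_layA a -> next_lay0 (rng a) /\ next_lay1 (src a).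
Proof.
move=> [q _ <-]; split; last by exists (val q).1.
exists (src (sel q)) => //.
have /asboolP qY := valP q; have /asboolP[Wu [Yu _]] := valP (val q).1.
suff /lay_ends[] : layA (sel q) by [].
by apply: lay_full; rewrite (Yu _ qY).
Qed.

Lemma next_full a : next_lay0 (rng a) -> next_layA a.
Proof.
case: a => [e|q]; last by exists q.
by move=> [v lv [vE]]; rewrite vE in lv; have := lay_source lv.
Qed.

Lemma next_source a : ~ next_lay1 (rng a).
Proof. by case: a => [e|q] []. Qed.

Definition next_stage : stage := Stage next_ends next_full next_source.
End NextStage.

Fixpoint F_ (n : nat) : stage := if n is n.+1 then next_stage (F_ n) else stage0.

(* The bipartite separated graph (E_n, C^n), as a subgraph of (F_n, D^n) *)
Section CanonicalSequence.
Variable n : nat.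

Lemma canon_ends (a : arr (F_ n)) : layA a ->
  (@lay0 (F_ n) `|` @lay1 (F_ n)) (rng a) /\ (@lay0 (F_ n) `|` @lay1 (F_ n)) (src a).
Proof. by move=> /lay_ends[? ?]; split; [left|right]. Qed.

Definition E_ : sepGraph := restrict canon_ends.

(* V_n = E_n^{0,0} *)
Definition V_ : set (vert E_) := [set v | lay0 (val v)].

End CanonicalSequence.

(* Every vertex of E_{n+1} is either a vertex of F^{0,n+1}, which is a vertex of
   E_n, or a vertex v(x_1, ..., x_k) of F_{n+1}, where x_1, ..., x_k are arrows
   of E_n. *)
Definition same_vertex n (v : vert (E_ n.+1)) (w : vert (multires (@V_ n))) : Prop :=
  match val v : mr_vert (@lay0 (F_ n)), w : mr_vert (@V_ n) with
  | inl a, inl b => a = val b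
  | inr p, inr q => (val p).1 = val (val q).1 /\ tup p = val @` tup q
  | _, _ => False
  end.

(* The union of the chain of the F_n, where the vertices and arrows of F_n are
   seen in F_{n+1} through inl. Its vertices (resp. arrows) are those of F_0,
   together with, for all n, the new ones of F_{n+1}. *)
Definition Finf_vert : choiceType :=
  (vert E + {n : nat & newVert (@lay0 (F_ n))})%type.
Definition Finf_arr : choiceType :=
  (arr E + {n : nat & newArr (@lay0 (F_ n))})%type.

Fixpoint to_vert n : vert (F_ n) -> Finf_vert :=
  match n with
  | 0 => inl
  | n.+1 => fun v : mr_vert (@lay0 (F_ n)) =>
      match v with
      | inl v => to_vert v
      | inr p => inr (Tagged (fun n => newVert (@lay0 (F_ n))) p)
      end
  end.

Fixpoint to_arr n : arr (F_ n) -> Finf_arr :=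
  match n with
  | 0 => inl
  | n.+1 => fun a : mr_arr (@lay0 (F_ n)) =>
      match a with
      | inl a => to_arr a
      | inr q => inr (Tagged (fun n => newArr (@lay0 (F_ n))) q)
      end
  end.

Definition Finf_rng (a : Finf_arr) : Finf_vert :=
  match a with
  | inl e => inl (rng e)
  | inr q => @to_vert (tag q).+1 (@rng (F_ (tag q).+1) (inr (tagged q)))
  end.

Definition Finf_src (a : Finf_arr) : Finf_vert :=
  match a with
  | inl e => inl (src e)
  | inr q => @to_vert (tag q).+1 (@src (F_ (tag q).+1) (inr (tagged q)))
  end.

Definition Finf_blk (v : Finf_vert) : set (set Finf_arr) :=
  [set X | exists n (w : vert (F_ n)) (Y : set (arr (F_ n))),
     [/\ to_vert w = v, blk w Y & X = @to_arr n @` Y]].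

Lemma Finf_rngE n (a : arr (F_ n)) : Finf_rng (to_arr a) = to_vert (rng a).
Proof. by elim: n a => [//|n IHn] [a|q] //=; rewrite IHn. Qed.

Lemma Finf_srcE n (a : arr (F_ n)) : Finf_src (to_arr a) = to_vert (src a).
Proof. by elim: n a => [//|n IHn] [a|q] //=; rewrite IHn. Qed.

Lemma to_vert_lt n (v : vert (F_ n)) p : to_vert v = inr p -> (tag p < n)%N.
Proof.
elim: n v => [//|n IHn] [v|q] /=; first by move=> /IHn /ltnW.
by move=> [<-].
Qed.

Lemma to_arr_lt n (a : arr (F_ n)) p : to_arr a = inr p -> (tag p < n)%N.
Proof.
elim: n a => [//|n IHn] [a|q] /=; first by move=> /IHn /ltnW.
by move=> [<-].
Qed.

Lemma to_vert_inj n : injective (@to_vert n).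
Proof.
elim: n => [|n IHn]; first by move=> u v [].
move=> [u|p] [v|q] /=.
- by move=> /IHn ->.
- by move=> /to_vert_lt; rewrite ltnn.
- by move=> /esym/to_vert_lt; rewrite ltnn.
- by case=> /eqP; rewrite eq_Tagged => /eqP /= ->.
Qed.

Lemma to_arr_inj n : injective (@to_arr n).
Proof.
elim: n => [|n IHn]; first by move=> u v [].
move=> [u|p] [v|q] /=.
- by move=> /IHn ->.
- by move=> /to_arr_lt; rewrite ltnn.
- by move=> /esym/to_arr_lt; rewrite ltnn.
- by case=> /eqP; rewrite eq_Tagged => /eqP /= ->.
Qed.

Lemma to_arr_surj a : exists n (b : arr (F_ n)), to_arr b = a.
Proof.
case: a => [e|[n q]]; first by exists 0, e.
by exists n.+1, (inr q).
Qed.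

Lemma Finf_blk_up k n (w : vert (F_ n)) (Y : set (arr (F_ n))) : blk w Y ->
  exists (w' : vert (F_ (k + n))) (Y' : set (arr (F_ (k + n)))),
    [/\ to_vert w' = to_vert w, blk w' Y' & @to_arr n @` Y = @to_arr (k + n) @` Y'].
Proof.
move=> DY; elim: k => [|k [w' [Y' [ww' DY' YY']]]]; first by exists w, Y.
exists (inl w'), (inl @` Y'); split=> //; first by left; exists Y'.
by rewrite YY'; apply/seteqP; split=> [_ [a Ya <-]|_ [_ [a Ya <-] <-]];
  [exists (inl a) => //; exists a|exists a].
Qed.

Lemma Finf_blkP v : partition (Finf_blk v) id (Finf_rng @^-1` [set v]).
Proof.
apply/partition_idP; split.
- move=> X [n [w [Y [<- DY ->]]]] _ [a Ya <-] /=; rewrite Finf_rngE.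
  by have /partition_idP[/(_ _ DY _ Ya) <-] := blkP w.
- move=> a av; have [n [b ba]] := to_arr_surj a.
  have /partition_idP[_ cov _ _] := blkP (rng b).
  have [Y DY Yb] := cov b erefl.
  exists (@to_arr n @` Y); last by exists b.
  by exists n, (rng b), Y; split=> //; rewrite -Finf_rngE ba.
- move=> X X' a [n [w [Y [wv DY ->]]]] [m [z [Z [zv DZ ->]]]].
  have [w' [Y' [ww' DY' ->]]] := Finf_blk_up m DY.
  have [z' [Z' [zz' DZ' ->]]] := Finf_blk_up n DZ.
  rewrite wv in ww'; rewrite zv in zz'.
  move: (n + m)%N (addnC n m) z' Z' zz' DZ' => _ -> z' Z' zz' DZ'.
  have wz : w' = z' by apply: to_vert_inj; rewrite ww' zz'.
  rewrite -{}wz {z' zz'} in DZ'.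
  have /partition_idP[_ _ triv _] := blkP w'.
  move=> [b Yb <-] [c Zc /to_arr_inj cb]; rewrite cb in Zc.
  by rewrite (triv _ _ _ DY' DZ' Yb Zc).
- move=> X [n [w [Y [_ DY ->]]]].
  have /partition_idP[_ _ _ /(_ _ DY) [b Yb]] := blkP w.
  by exists (to_arr b); exists b.
Qed.

Definition Finf : sepGraph := SepGraph Finf_src Finf_blkP.

End CompleteMultiresolution.

(* Main.v *)
From HB Require Import structures.
From mathcomp Require Import all_boot all_algebra.
From mathcomp Require Import boolp classical_sets functions cardinality fsbigop.
From mathcomp Require Import zify.
(* Imported last, so that [transversal] is the notion for separated graphs and
   not the one for partitions of finite sets. *)
Require Import Defs.

(** Let G' be the multiresolution of G at a set W of vertices. M(G') is generated
    by M(G) and by the new vertices, subject to the relations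
      a_(s(x)) = sum of the a_p, for the new vertices p whose tuple contains x,
    for the arrows x into W: the relation that expresses a_u, for u in W, as the
    sum of the new vertices over u follows, because a tuple contains exactly one
    arrow of each block. So M(G') is a pushout of M(G) and of the free monoid on
    the new vertices, over the submonoid S of the functions on the tuples which
    are sums of functions of one coordinate. Such a sum determines its terms up
    to constants which cancel out in M(G) ([transversal_sum_inj]), so that S maps
    to M(G); and S is closed under differences ([transversal_sum_unitary]).
    Therefore, when a word in the vertices of G' is the image of an element of
    M(G), this element can be read off from the word, and is invariant under the
    relations of M(G'). This makes M(G) -> M(G') a unitary embedding
    ([mr_unitary]).

    The vertices of F_n outside of its last two layers, which are those of E_n,
    have generators that are sums of generators of the last layers. By induction
    on n this gives an inverse of M(E_n) -> M(F_n) ([retract_stage0],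
    [retract_next]). For the same reason the multiresolution of E_n and
    F_(n+1), the multiresolution of F_n at the same vertices, have the same
    monoid ([multires_top]). The maps phi_n and iota_n come from these two
    isomorphisms and from the embedding M(F_n) -> M(F_(n+1)).

    Both M(F_oo) and the direct limit are colimits of the M(F_n) = M(E_n), hence
    isomorphic ([Finf_lift], [dirlim_lift]). That M(E) -> M(F_oo) is a unitary
    embedding is inherited from the finite stages, since a congruence of words
    involves finitely many of them ([Finf_cong_stage]).

    M(F_oo) is a refinement monoid because of a confluence property: the words
    of the sources of two blocks at u are both refined, one stage later, into the
    word of the new vertices over u ([Finf_block_refines]). So, for the rewriting
    which replaces letters by the sources of their blocks, two congruent words
    rewrite to the same word ([cong_join]); as the rewriting acts letterwise,
    two equal sums have a common refinement ([confluent_refinement]).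

    Lastly, a homomorphism from M(G) to a refinement monoid P extends to M(G'),
    since the decompositions of the image of a_u given by the blocks at u have a
    common refinement in P, indexed by the tuples ([refine_selections],
    [mr_extend]); going through all stages extends it to M(F_oo)
    ([Finf_universal]). *)

Set Implicit Arguments.
Unset Strict Implicit.
Unset Printing Implicit Defensive.

Import GRing.Theory.
Local Open Scope classical_set_scope.
Local Open Scope ring_scope.

(** * Sums over finite sets *)

Lemma exchange_fsbig_dep (R : Type) (idx : R) (op : Monoid.com_law idx)
    (I J : choiceType) (A : set I) (B : I -> set J) (C : set J) (D : J -> set I)
    (F : I -> J -> R) :
    finite_set A -> finite_set C ->
    (forall i j, A i /\ B i j <-> C j /\ D j i) ->
  \big[op/idx]_(i \in A) \big[op/idx]_(j \in B i) F i j =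
  \big[op/idx]_(j \in C) \big[op/idx]_(i \in D j) F i j.
Proof.
move=> finA finC ABCD.
transitivity (\big[op/idx]_(i \in A) \big[op/idx]_(j \in C)
    (if j \in B i then F i j else idx)).
  apply: eq_fsbigr => i /set_mem Ai; rewrite -fsbig_mkcondr; apply: eq_fsbigl.
  apply/seteqP; split=> [j Bij|j [] //].
  by have [] := (ABCD i j).1 (conj Ai Bij).
rewrite exchange_fsbig//; apply: eq_fsbigr => j /set_mem Cj.
have -> : D j = A `&` D j.
  apply/seteqP; split=> [i Dji|i [] //].
  by have [] := (ABCD i j).2 (conj Cj Dji).
rewrite fsbig_mkcondr; apply: eq_fsbigr => i /set_mem Ai.
congr (if _ then _ else _); apply/idP/idP=> /set_mem ?; apply: mem_set.
  by have [] := (ABCD i j).1 _.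
by have [] := (ABCD i j).2 _.
Qed.

Lemma fsbig_fibers (R : Type) (idx : R) (op : Monoid.com_law idx)
    (I J : choiceType) (A : set I) (C : set J) (c : I -> J) (F : I -> R) :
    finite_set A -> finite_set C -> (forall i, A i -> C (c i)) ->
  \big[op/idx]_(i \in A) F i =
  \big[op/idx]_(j \in C) \big[op/idx]_(i \in [set i | A i /\ c i = j]) F i.
Proof.
move=> finA finC Ac.
rewrite -(@exchange_fsbig_dep _ _ _ _ _ A (fun i => [set c i]))//.
  by apply: eq_fsbigr => i _; rewrite fsbig_set1.
by move=> i j; split=> [[Ai ->]|[_ [Ai <-]]]; split=> //; exact: Ac.
Qed.

Lemma fsbig_indic (R : Type) (idx : R) (op : Monoid.com_law idx)
    (I : choiceType) (A : set I) (F : I -> R) (i : I) :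
    (forall j, A j -> j <> i -> F j = idx) ->
  \big[op/idx]_(j \in A) F j = if `[< A i >] then F i else idx.
Proof.
move=> F0; case: asboolP => Ai; last first.
  by apply: fsbig1 => j Aj; apply: F0 => // ji; rewrite ji in Aj.
rewrite -(fsbig_set1 op i F); symmetry.
apply: fsbig_widen => [_ ->//|j [Aj ji]].
exact: F0.
Qed.

Lemma raddf_fsum (U V : nmodType) (h : {additive U -> V}) (I : choiceType)
    (A : set I) (F : I -> U) : finite_set A ->
  h (\sum_(i \in A) F i) = \sum_(i \in A) h (F i).
Proof. by move=> finA; rewrite !fsbig_finite// raddf_sum. Qed.

Lemma mulrn_fsum (U : nmodType) (x : U) (I : choiceType) (A : set I)
    (g : I -> nat) : finite_set A ->
  x *+ (\big[addn/0%N]_(i \in A) g i) = \sum_(i \in A) x *+ g i.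
Proof.
by move=> finA; rewrite !fsbig_finite// (big_morph _ (mulrnDr x) (mulr0n x)).
Qed.

Lemma fsumMn (U : nmodType) (I : choiceType) (A : set I) (F : I -> U) n :
    finite_set A ->
  (\sum_(i \in A) F i) *+ n = \sum_(i \in A) F i *+ n.
Proof. by move=> finA; rewrite !fsbig_finite// sumrMnl. Qed.

Lemma fsumD (U : nmodType) (I : choiceType) (A : set I) (F G : I -> U) :
    finite_set A ->
  \sum_(i \in A) (F i + G i) = \sum_(i \in A) F i + \sum_(i \in A) G i.
Proof. exact: fsbig_split. Qed.

Lemma fsum_nD (I : choiceType) (A : set I) (F G : I -> nat) : finite_set A ->
  \big[addn/0%N]_(i \in A) (F i + G i)%N =
  (\big[addn/0%N]_(i \in A) F i + \big[addn/0%N]_(i \in A) G i)%N.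
Proof. exact: fsbig_split. Qed.

Lemma finite_setTT (T : Type) (A : set T) : finite_set [set: T] -> finite_set A.
Proof. exact: sub_finite_set. Qed.

Lemma finite_set_enum (T : choiceType) (A : set T) : finite_set A ->
  exists2 l : seq T, uniq l & A = [set` l].
Proof.
move=> finA; exists (finmap.enum_fset (fset_set A)).
  exact: finmap.fset_uniq.
by apply/seteqP; split=> x; rewrite /= in_fset_set// inE.
Qed.

(** * Presented monoids *)

Section Presented.
Variables (T : choiceType) (R : seq T -> seq T -> Prop).

Lemma pclass_cat w w' : pclass R (w ++ w') = pclass R w + pclass R w'.
Proof. by rewrite -[RHS]/(padd _ _) padd_pclass. Qed.

Lemma pclass_sum w : pclass R w = \sum_(t <- w) pgen R t.
Proof.
elim: w => [|t w IHw]; first by rewrite big_nil.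
by rewrite big_cons -IHw -pclass_cat.
Qed.

Lemma pcong_perm w w' : perm_eq w w' -> pcong R w w'.
Proof.
by move=> ww'; apply/pclassP; rewrite !pclass_sum; apply: perm_big.
Qed.

Lemma presented_ext (P : nmodType) (h h' : {additive presented R -> P}) :
  (forall t, h (pgen R t) = h' (pgen R t)) -> h =1 h'.
Proof.
move=> hh' x; rewrite -(pclass_repr x) pclass_sum !raddf_sum.
exact: eq_bigr.
Qed.

Section Lift.
Variables (P : nmodType) (g : T -> P).
Hypothesis gR : forall w w', R w w' -> \sum_(t <- w) g t = \sum_(t <- w') g t.

Lemma pcong_lift w w' : pcong R w w' ->
  \sum_(t <- w) g t = \sum_(t <- w') g t.
Proof.
elim=> {w w'} [||//|//|w w' w'' _ -> _ -> //|w w' z z' _ ww' _ zz'].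
- exact: gR.
- by move=> w w'; rewrite !big_cat /= addrC.
- by rewrite !big_cat ww' zz'.
Qed.

Definition plift (x : presented R) : P := \sum_(t <- repr x) g t.

Lemma plift_pclass w : plift (pclass R w) = \sum_(t <- w) g t.
Proof. by apply: pcong_lift; apply/pclassP; rewrite pclass_repr. Qed.

Lemma plift_additive : nmod_morphism plift.
Proof.
split=> [|x y]; first by rewrite -[0]/(pclass R [::]) plift_pclass big_nil.
rewrite -(pclass_repr x) -(pclass_repr y) -pclass_cat !plift_pclass.
by rewrite big_cat /=.
Qed.

HB.instance Definition _ :=
  Algebra.isNmodMorphism.Build (presented R) P plift plift_additive.

Lemma presented_lift :
  exists h : {additive presented R -> P}, forall t, h (pgen R t) = g t.
Proof. by exists plift => t; rewrite /= plift_pclass big_seq1. Qed.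

End Lift.
End Presented.

(** * The monoid of a separated graph *)

Section GraphMonoid.
Variable G : sepGraph.
Implicit Types (v : vert G) (X : set (arr G)).

Lemma blk_sub v X e : blk v X -> X e -> rng e = v.
Proof. by have /partition_idP[sub _ _ _] := blkP v => DX; apply: sub. Qed.

Lemma blk_cover (e : arr G) : exists2 X, blk (rng e) X & X e.
Proof. by have /partition_idP[_ cov _ _] := blkP (rng e); apply: cov. Qed.

Lemma blk_uniq v X Y e : blk v X -> blk v Y -> X e -> Y e -> X = Y.
Proof. by have /partition_idP[_ _ triv _] := blkP v; apply: triv. Qed.

Lemma blk_neq0 v X : blk v X -> exists e, X e.
Proof. by have /partition_idP[_ _ _ ne] := blkP v => /ne. Qed.

Lemma agen_blk v X : blk v X -> finite_set X ->
  agen v = \sum_(e \in X) agen (src e).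
Proof.
move=> DX /finite_set_enum[l ul Xl].
have -> : agen v = pclass (@mon_rel G) [seq src e | e <- l].
  apply/pclassP; apply: pcong_rel; exact: MonRel DX ul Xl.
by rewrite pclass_sum big_map Xl fsbig_seq.
Qed.

(** The universal property of M(E,C), with sums over blocks instead of words. *)
Lemma Mon_lift (P : nmodType) (g : vert G -> P) :
    (forall v X, blk v X -> finite_set X -> g v = \sum_(e \in X) g (src e)) ->
  exists h : {additive Mon G -> P}, forall v, h (agen v) = g v.
Proof.
move=> gP; apply: presented_lift => _ _ [v X l DX ul Xl].
rewrite big_seq1 big_map fsbig_seq// -Xl; apply: gP => //.
by rewrite Xl; apply: finite_seq.
Qed.

Lemma Mon_ext (P : nmodType) (h h' : {additive Mon G -> P}) :
  (forall v, h (agen v) = h' (agen v)) -> h =1 h'.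
Proof. exact: presented_ext. Qed.

Lemma MonE (x : Mon G) : exists w : seq (vert G), x = \sum_(v <- w) agen v.
Proof. by exists (repr x); rewrite -pclass_sum pclass_repr. Qed.

(** Blocks are not empty, so that no word with letters is congruent to the empty
    one. *)
Lemma Mon_conical : conical (Mon G).
Proof.
have nil w w' : pcong (@mon_rel G) w w' -> nilp w = nilp w'.
  elim=> {w w'} [w w' [v X l DX ul Xl]|w w'|//|//|w w' w'' _ -> //|].
  - have [e] := blk_neq0 DX; rewrite Xl /=.
    by case: l {ul Xl} => [|//]; rewrite /= in_nil.
  - by rewrite !cat_nilp andbC.
  - by move=> w w' z z' _ + _ +; rewrite !cat_nilp => -> ->.
move=> a b; rewrite -(pclass_repr a) -(pclass_repr b) -pclass_cat.
rewrite -[0]/(pclass (@mon_rel G) [::]).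
move=> /pclassP /nil; rewrite cat_nilp => /andP[/nilP -> /nilP ->].
by split.
Qed.

End GraphMonoid.

(** * Sums over transversals *)

Section Transversals.
Variable G : sepGraph.
Hypothesis finA : finite_set [set: arr G].
Implicit Types (x y : arr G) (X Y : set (arr G)) (g k : arr G -> nat).

Definition blk_of x : set (arr G) := projT1 (cid2 (blk_cover x)).

Lemma blk_ofP x : blk (rng x) (blk_of x).
Proof. by rewrite /blk_of; case: cid2. Qed.

Lemma mem_blk_of x : blk_of x x.
Proof. by rewrite /blk_of; case: cid2. Qed.

Lemma blk_ofE u X x : blk u X -> X x -> X = blk_of x.
Proof.
move=> DX Xx; have ux := blk_sub DX Xx; rewrite -{u}ux in DX.
exact: blk_uniq DX (blk_ofP x) Xx (mem_blk_of x).
Qed.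

Lemma blk_of_eq x y : blk_of x y -> blk_of y = blk_of x.
Proof. by move=> xy; rewrite -(blk_ofE (blk_ofP x) xy). Qed.

Lemma blk_of_rng x y : blk_of x y -> rng y = rng x.
Proof. exact/blk_sub/blk_ofP. Qed.

Variable u : vert G.

Lemma transversal_rng Y y : transversal u Y -> Y y -> rng y = u.
Proof. by move=> [Yu _]; apply: Yu. Qed.

Lemma transversal_rep Y : transversal u Y ->
  exists c : arr G -> arr G, forall x, rng x = u ->
    [/\ Y (c x), blk_of x (c x) & forall y, Y y -> blk_of x y -> y = c x].
Proof.
move=> [Yu Yx].
have /choice[c cP] : forall x, exists c, rng x = u ->
    [/\ Y c, blk_of x c & forall y, Y y -> blk_of x y -> y = c].
  move=> x; have [xu|xu] := pselect (rng x = u); last by exists x.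
  have := blk_ofP x; rewrite xu => /Yx[c [[Xc Yc] cP]]; exists c => _.
  by split=> // y Yy Xy; rewrite (cP y).
by exists c.
Qed.

(** Here [c x] is meant to be the element of [Y] in the block of [x], so that the
    result is again a transversal. *)
Definition swap Y (c : arr G -> arr G) x : set (arr G) := x |` (Y `\ c x).

Section Representatives.
Variables (Y : set (arr G)) (c : arr G -> arr G).
Hypothesis tY : transversal u Y.
Hypothesis cP : forall x, rng x = u ->
    [/\ Y (c x), blk_of x (c x) & forall y, Y y -> blk_of x y -> y = c x].

Lemma rep_fiber y : Y y ->
  [set x | (rng @^-1` [set u]) x /\ c x = y] = blk_of y.
Proof.
move=> Yy; have yu := transversal_rng tY Yy.
apply/seteqP; split=> x.
  by move=> [xu <-]; have [_ /blk_of_eq -> _] := cP xu; apply: mem_blk_of.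
move=> yx; have xu : rng x = u by rewrite (blk_of_rng yx).
split=> //; have [_ _ cx] := cP xu; symmetry; apply: cx => //.
by rewrite (blk_of_eq yx); apply: mem_blk_of.
Qed.

Lemma rep_bij Z : transversal u Z -> set_bij Z Y c.
Proof.
move=> tZ; split.
- by move=> x Zx; have [] := cP (transversal_rng tZ Zx).
- move=> x y /set_mem Zx /set_mem Zy cxy.
  have [_ xc _] := cP (transversal_rng tZ Zx).
  have [_ yc _] := cP (transversal_rng tZ Zy).
  have [z [_ zP]] := tZ.2 _ (eq_ind _ (fun v => blk v (blk_of x)) (blk_ofP x) _
                               (transversal_rng tZ Zx)).
  rewrite -(zP x) ?(zP y)//; split=> //; last exact: mem_blk_of.
  by rewrite -(blk_of_eq xc) cxy (blk_of_eq yc); apply: mem_blk_of.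
- move=> y Yy; have yu := transversal_rng tY Yy.
  have := blk_ofP y; rewrite yu => /tZ.2[z [[yz Zz] _]].
  exists z => //; have zu := transversal_rng tZ Zz.
  have [_ _ cz] := cP zu; symmetry; apply: cz => //.
  by rewrite (blk_of_eq yz); apply: mem_blk_of.
Qed.

Lemma swap_transversal x : rng x = u -> transversal u (swap Y c x).
Proof.
move=> xu; have [Ycx xcx cx] := cP xu; split=> [y [->//|[Yy _]]|X DX].
  exact: transversal_rng tY Yy.
have [Xx|nXx] := pselect (X x).
  exists x; split=> [|y [Xy [->//|[Yy ycx]]]]; first by split=> //; left.
  by case: ycx; apply: cx => //; rewrite -(blk_ofE DX Xx).
have [y [[Xy Yy] yP]] := tY.2 X DX; exists y; split.
  split=> //; right; split=> // yE; apply: nXx.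
  rewrite (blk_ofE DX Xy) yE (blk_of_eq xcx); exact: mem_blk_of.
by move=> z [Xz [zx|[Yz _]]]; [rewrite zx in Xz|apply: yP].
Qed.

Lemma swap_sum g x : rng x = u ->
  (\big[addn/0%N]_(y \in swap Y c x) g y + g (c x) =
   \big[addn/0%N]_(y \in Y) g y + g x)%N.
Proof.
move=> xu; have [Ycx xcx cx] := cP xu.
rewrite (fsbigD1 x (swap Y c x)); [|exact: finite_setTT|by left].
rewrite (fsbigD1 (c x) Y) //=; last exact: finite_setTT.
have -> : swap Y c x `\ x = Y `\ c x; last by lia.
apply/seteqP; split=> [y [[-> /(_ erefl)[]|Yy _ //]]|y [Yy yc]].
split; first by right.
by move=> yx; apply: yc; apply: cx => //; rewrite yx; apply: mem_blk_of.
Qed.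

End Representatives.

(** A function on the arrows into [u] is known, on each block, up to the same
    constant on the whole block, from its sums over the transversals; the block
    constants cancel out since every block has the same sum [t]. *)
Lemma transversal_sum_inj (U : nmodType) (a : arr G -> U) (t : U) k k' :
    (forall X, blk u X -> \sum_(x \in X) a x = t) ->
    (forall Y, transversal u Y ->
       \big[addn/0%N]_(x \in Y) k x = \big[addn/0%N]_(x \in Y) k' x) ->
  \sum_(x \in rng @^-1` [set u]) a x *+ k x =
  \sum_(x \in rng @^-1` [set u]) a x *+ k' x.
Proof.
move=> aX kk'.
have [[x0 x0u]|no] := pselect (exists x, rng x = u); last first.
  by rewrite !fsbig1// => x xu; case: no; exists x.
have [Y tY _] := ex_transversal x0; rewrite x0u in tY.
have [c cP] := transversal_rep tY.
have fin (A : set (arr G)) : finite_set A := finite_setTT A finA.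
have cY x : (rng @^-1` [set u]) x -> Y (c x) by move=> xu; have [] := cP x xu.
rewrite [LHS](fsbig_fibers _ _ (fin _) (fin Y) cY).
rewrite [RHS](fsbig_fibers _ _ (fin _) (fin Y) cY).
(* On each block, [k] and [k'] differ by a constant; [l] is their common part. *)
pose m y := minn (k y) (k' y).
pose l x := (k x - (k (c x) - m (c x)))%N.
have kl x : rng x = u -> k x = (l x + (k (c x) - m (c x)))%N /\
    k' x = (l x + (k' (c x) - m (c x)))%N.
  move=> xu; have tx := swap_transversal tY cP xu.
  have := kk' _ tx; have := kk' _ tY; rewrite /l /m.
  have := swap_sum cP k xu; have := swap_sum cP k' xu; lia.
have split_sum (q : arr G -> nat) :
    (forall x, rng x = u -> q x = (l x + (q (c x) - m (c x)))%N) ->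
  \sum_(y \in Y)
    \sum_(x \in [set x | (rng @^-1` [set u]) x /\ c x = y]) a x *+ q x
  = \sum_(y \in Y) (\sum_(x \in blk_of y) a x *+ l x)
    + t *+ (\big[addn/0%N]_(y \in Y) (q y - m y)%N).
  move=> ql; rewrite mulrn_fsum// -fsumD//; apply: eq_fsbigr => y /set_mem Yy.
  have yu := transversal_rng tY Yy.
  have := blk_ofP y; rewrite yu => /aX <-.
  rewrite fsumMn// -fsumD// (rep_fiber tY cP Yy).
  apply: eq_fsbigr => x /set_mem yx.
  have xu : rng x = u by rewrite (blk_of_rng yx).
  have cx : c x = y.
    have [_ _ cx] := cP x xu; symmetry; apply: cx => //.
    by rewrite (blk_of_eq yx); apply: mem_blk_of.
  by rewrite -mulrnDr [in LHS]ql// cx.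
rewrite (split_sum k) => [|x /kl[]//]; rewrite (split_sum k') => [|x /kl[]//].
congr (_ + t *+ _).
apply/eqP; rewrite -(eqn_add2r (\big[addn/0%N]_(y \in Y) m y)); apply/eqP.
rewrite -!fsum_nD//; transitivity (\big[addn/0%N]_(y \in Y) k y).
  by apply: eq_fsbigr => y _; rewrite subnK// geq_minl.
by rewrite kk'//; apply: eq_fsbigr => y _; rewrite subnK// geq_minr.
Qed.

(** The sums over the transversals of functions on the arrows into [u] form a
    unitary submonoid: if [f] is a difference of two of them, then the increase
    of [f] when its minimal transversal is changed at one place is a function on
    the arrows, which recovers [f] up to the minimum of [f]. *)
Lemma transversal_sum_unitary (f : set (arr G) -> nat) g g' x0 : rng x0 = u ->
    (forall Y, transversal u Y ->
       (f Y + \big[addn/0%N]_(x \in Y) g x)%N = \big[addn/0%N]_(x \in Y) g' x) ->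
  exists h : arr G -> nat, forall Y, transversal u Y ->
    f Y = \big[addn/0%N]_(x \in Y) h x.
Proof.
move=> x0u fg.
have fin (A : set (arr G)) : finite_set A := finite_setTT A finA.
have [Y [tY minY]] : exists Y, transversal u Y /\
    forall Z, transversal u Z -> (f Y <= f Z)%N.
  have exf : exists n, `[< exists2 Y, transversal u Y & f Y = n >].
    have [Y tY _] := ex_transversal x0; rewrite x0u in tY.
    by exists (f Y); apply/asboolP; exists Y.
  case: (ex_minnP exf) => n /asboolP[Y tY <-] minY; exists Y; split=> // Z tZ.
  by apply: minY; apply/asboolP; exists Z.
have [c cP] := transversal_rep tY.
(* The subtraction is exact, since [Y] is minimal. The minimum [f Y] has to be
   added once on each transversal: this is done on the block of [x0]. *)
pose e x := (f (swap Y c x) - f Y)%N.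
pose X0 := blk_of x0.
have DX0 : blk u X0 by rewrite -x0u; apply: blk_ofP.
exists (fun x => e x + (if `[< X0 x >] then f Y else 0))%N => Z tZ.
have eP x : Z x -> (e x + g x + g' (c x) = g' x + g (c x))%N.
  move=> Zx; have xu := transversal_rng tZ Zx.
  have tx := swap_transversal tY cP xu.
  have := fg _ tx; have := fg _ tY; have := minY _ tx; rewrite /e.
  have := swap_sum cP g xu; have := swap_sum cP g' xu; lia.
have : \big[addn/0%N]_(x \in Z) (e x + g x + g' (c x))%N
     = \big[addn/0%N]_(x \in Z) (g' x + g (c x))%N.
  by apply: eq_fsbigr => x /set_mem; apply: eP.
rewrite !fsum_nD//.
have reindex (q : arr G -> nat) :
    \big[addn/0%N]_(x \in Z) q (c x) = \big[addn/0%N]_(y \in Y) q y.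
  by symmetry; apply: reindex_fsbig; exact: (rep_bij tY cP tZ).
rewrite !reindex -!fg//.
have -> : \big[addn/0%N]_(x \in Z) (if `[< X0 x >] then f Y else 0%N) = f Y.
  have [z [[X0z Zz] zP]] := tZ.2 _ DX0.
  rewrite (@fsbig_indic _ _ _ _ _ _ z).
    by rewrite !asboolT.
  by move=> x Zx xz; case: asboolP => // X0x; case: xz; rewrite (zP x).
lia.
Qed.

End Transversals.

(** * The monoid of a multiresolution *)

(** A new vertex is a pair made of a vertex and of a set of arrows, so this keeps
    the multiresolution of a finite graph finite. *)
Lemma finite_powerset (T : choiceType) :
  finite_set [set: T] -> finite_set [set: set T].
Proof.
move=> /finite_set_enum[l _ Tl].
have -> : [set: set T] =
    (fun t : (size l).-tuple bool => [set` mask t l]) @` setT.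
  apply/seteqP; split=> // A _.
  exists [tuple of [seq `[< A x >] | x <- in_tuple l]] => //=.
  rewrite -filter_mask; apply/seteqP; split=> x /=.
    by rewrite mem_filter => /andP[/asboolP].
  move=> Ax; rewrite mem_filter; apply/andP; split; first exact/asboolP.
  by have : [set` l] x by rewrite -Tl.
exact/finite_image/finite_finset.
Qed.

Lemma finite_val (T : choiceType) (P : pred T) (S : subChoiceType P) :
  finite_set [set: T] -> finite_set [set: S].
Proof.
move=> /finite_set_enum[l _ Tl].
suff -> : [set: S] = [set` pmap insub l] by exact: finite_seq.
apply/seteqP; split=> // x _; rewrite /= mem_pmap_sub.
by have : [set` l] (val x) by rewrite -Tl.
Qed.

Lemma finite_sum (A B : Type) : finite_set [set: A] -> finite_set [set: B] ->
  finite_set [set: (A + B)%type].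
Proof.
move=> finA finB.
have -> : [set: (A + B)%type] = inl @` setT `|` inr @` setT.
  by apply/seteqP; split=> // -[a|b] _; [left; exists a|right; exists b].
by rewrite finite_setU; split; apply: finite_image.
Qed.

Section Multires.
Variables (G : sepGraph) (W : set (vert G)).
Implicit Types (x : arr G) (p q : newVert W).

Definition base p : vert G := (val p).1.
Definition thru x : set (newVert W) := [set p | tup p x].
(** [mr_block x] retyped, so that [src] and [blk] of the multiresolution apply to
    its elements and to itself. *)
Definition new_arrows x : set (arr (multires W)) := @mr_block G W x.
Definition over (u : vert G) : set (newVert W) := [set p | base p = u].

Lemma base_in p : W (base p).
Proof. by have /asboolP[] := valP p. Qed.

Lemma tup_transversal p : transversal (base p) (tup p).
Proof. by have /asboolP[] := valP p. Qed.

Lemma tup_rng p x : tup p x -> rng x = base p.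
Proof. exact/transversal_rng/tup_transversal. Qed.

Lemma tup_in p x : tup p x -> W (rng x).
Proof. by move=> /tup_rng ->; apply: base_in. Qed.

Lemma newVert_eq p q : base p = base q -> tup p = tup q -> p = q.
Proof.
move=> bpq tpq; apply: val_inj; move: bpq tpq; rewrite /base /tup.
by case: (val p) (val q) => [u Y] [v Z] /= -> ->.
Qed.

Lemma newVert_ex u (Y : set (arr G)) : W u -> transversal u Y ->
  exists2 p, base p = u & tup p = Y.
Proof.
move=> Wu tY; have pP : `[< W (u, Y).1 /\ transversal (u, Y).1 (u, Y).2 >].
  exact/asboolP.
by exists (exist _ (u, Y) pP).
Qed.

Lemma thru_neq0 x : W (rng x) -> exists p, thru x p.
Proof.
move=> Wx; have [Y tY Yx] := ex_transversal x.
by have [p _ pY] := newVert_ex Wx tY; exists p; rewrite /thru /= pY.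
Qed.

Lemma newArr_ex p x : tup p x ->
  exists2 a : arr (multires W), new_arrows x a & src a = inr p.
Proof.
move=> px; have qP : `[< tup (p, x).1 (p, x).2 >] by apply/asboolP.
exists (inr (exist _ (p, x) qP)) => //.
by exists (exist _ (p, x) qP).
Qed.

Hypothesis finV : finite_set [set: vert G].
Hypothesis finA : finite_set [set: arr G].

Lemma finite_newVert : finite_set [set: newVert W].
Proof.
apply: finite_val; rewrite -setXTT; apply: finite_setX => //.
exact: finite_powerset.
Qed.

Lemma finite_mr_vert : finite_set [set: vert (multires W)].
Proof. exact: finite_sum finite_newVert. Qed.

Lemma finite_mr_arr : finite_set [set: arr (multires W)].
Proof.
apply: finite_sum => //; apply: finite_val; rewrite -setXTT.
exact: finite_setX finite_newVert finA.
Qed.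

Let finNV (A : set (newVert W)) : finite_set A.
Proof. exact: finite_setTT finite_newVert. Qed.
Let finAG (A : set (arr G)) : finite_set A.
Proof. exact: finite_setTT. Qed.
Let finMA (A : set (arr (multires W))) : finite_set A.
Proof. exact: finite_setTT finite_mr_arr. Qed.

Section Sums.
Variables (R : Type) (idx : R) (op : Monoid.com_law idx).

Lemma mr_src_inj x : set_inj (new_arrows x) (@src (multires W)).
Proof.
move=> _ _ /set_mem[q qx <-] /set_mem[r rx <-] [qr]; congr inr; apply: val_inj.
move: qx rx; rewrite /sel /=; move: qr.
by case: (val q) (val r) => [p y] [s z] /= -> -> ->.
Qed.

Lemma mr_src_image x : @src (multires W) @` new_arrows x = inr @` thru x.
Proof.
apply/seteqP; split=> [_ [_ [q <- <-] <-]|_ [p px <-]].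
  by exists (val q).1 => //; have /asboolP := valP q.
by have [a ax ap] := newArr_ex px; exists a.
Qed.

Lemma mr_block_sum x (F : vert (multires W) -> R) :
  \big[op/idx]_(a \in new_arrows x) F (src a) =
  \big[op/idx]_(p \in thru x) F (inr p).
Proof.
rewrite -(fsbig_image _ _ F (@mr_src_inj x)) mr_src_image.
by rewrite fsbig_image// => p q _ _ [].
Qed.

(** Each new vertex over [u] chooses exactly one arrow in a given block. *)
Lemma sum_over u X (F : newVert W -> R) : blk u X ->
  \big[op/idx]_(x \in X) \big[op/idx]_(p \in thru x) F p =
  \big[op/idx]_(p \in over u) F p.
Proof.
move=> DX; rewrite (@exchange_fsbig_dep _ _ _ _ _ X thru (over u)
  (fun p => X `&` tup p))//; last first.
  move=> x p; split=> [[Xx px]|[_ []] //].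
  by split=> //; rewrite /over /= -(tup_rng px) (blk_sub DX Xx).
apply: eq_fsbigr => p /set_mem pu.
have [_] := tup_transversal p; rewrite pu => /(_ _ DX)[x [[Xx px] xP]].
rewrite -[RHS](fsbig_set1 op x (fun=> F p)); apply: eq_fsbigl.
by apply/seteqP; split=> [y /xP ->|_ ->].
Qed.

End Sums.

Lemma mr_blk_inl u X : blk u X -> @blk (multires W) (inl u) (inl @` X).
Proof. by move=> DX; left; exists X. Qed.

Lemma mr_blk_new x : W (rng x) ->
  @blk (multires W) (inl (src x)) (new_arrows x).
Proof. by move=> Wx; right; exists x. Qed.

Lemma agen_thru x : W (rng x) ->
  agen (inl (src x) : vert (multires W)) =
  \sum_(p \in thru x) agen (inr p : vert (multires W)).
Proof.
move=> Wx; rewrite (agen_blk (mr_blk_new Wx))// mr_block_sum//.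
Qed.

Lemma mr_sum_inl (P : nmodType) (F : vert (multires W) -> P)
    (X : set (arr G)) :
  \sum_(a \in (inl : arr G -> arr (multires W)) @` X) F (src a) =
  \sum_(x \in X) F (inl (src x)).
Proof. by rewrite fsbig_image// => x y _ _ []. Qed.

(** Obtained from any block at [u], and independent of it: expand a_u along this
    block, then the source of each of its arrows along the new arrows. *)
Lemma agen_over u x : W u -> rng x = u ->
  agen (inl u : vert (multires W)) =
  \sum_(p \in over u) agen (inr p : vert (multires W)).
Proof.
move=> Wu xu; have [X] := blk_cover x; rewrite xu => DX _.
rewrite (agen_blk (mr_blk_inl DX))// mr_sum_inl -(sum_over _ _ DX).
by apply: eq_fsbigr => y /set_mem /(blk_sub DX) yu; rewrite agen_thru ?yu.
Qed.

(** The relations from the blocks of [G] hold because [h] is a homomorphism; only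
    the new blocks give a condition on [c]. *)
Lemma mr_lift (P : nmodType) (h : {additive Mon G -> P}) (c : newVert W -> P) :
    (forall x, W (rng x) -> h (agen (src x)) = \sum_(p \in thru x) c p) ->
  exists h' : {additive Mon (multires W) -> P},
    (forall v, h' (agen (inl v : vert (multires W))) = h (agen v)) /\
    (forall p, h' (agen (inr p : vert (multires W))) = c p).
Proof.
move=> hc.
pose g (v : vert (multires W)) : P :=
  match v with inl v => h (agen v) | inr p => c p end.
have gP (v : vert (multires W)) (X : set (arr (multires W))) :
    blk v X -> finite_set X -> g v = \sum_(e \in X) g (src e).
  case: v => [v|p] // [[Y DY <-] _|[x [Wx <-] <-] _].
    by rewrite mr_sum_inl /= (agen_blk DY)// raddf_fsum.
  by rewrite -[mr_block x]/(new_arrows x) mr_block_sum /= hc.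
have [h' h'E] := Mon_lift gP.
by exists h'; split=> [v|p]; rewrite h'E.
Qed.

Lemma mr_incl_ex : exists h : {additive Mon G -> Mon (multires W)},
  forall v, h (agen v) = agen (inl v : vert (multires W)).
Proof.
apply: Mon_lift => v X DX _.
by rewrite (agen_blk (mr_blk_inl DX))// mr_sum_inl.
Qed.

End Multires.
Arguments thru {G} W.
Arguments over {G} W.
Arguments new_arrows {G} W.

(** * Multiresolutions embed unitarily *)

Lemma unitary_comp (L M N : nmodType) (g : {additive M -> N})
    (f : {additive L -> M}) :
  unitary_embedding f -> unitary_embedding g -> unitary_embedding (g \o f).
Proof.
move=> [fI fC fU] [gI gC gU]; split.
- exact: inj_comp.
- move=> u; have [v [c ucv]] := gC u; have [w [d vdw]] := fC v.
  by exists w, (c + g d); rewrite addrA ucv -raddfD vdw.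
- move=> u u' v /= uvu'; have [w vw] := gU _ _ _ uvu'.
  rewrite vw -raddfD in uvu'; have [x wx] := fU _ _ _ (gI _ _ uvu').
  by exists x; rewrite /= -wx.
Qed.

Lemma unitary_bij (M N : nmodType) (f : {additive M -> N}) :
  bijective f -> unitary_embedding f.
Proof.
move=> [g fK gK]; split.
- exact: can_inj fK.
- by move=> u; exists (g u), 0; rewrite gK addr0.
- by move=> u u' v _; exists (g v); rewrite gK.
Qed.

Section Embedding.
Variables (G : sepGraph) (W : set (vert G)).
Hypothesis finV : finite_set [set: vert G].
Hypothesis finA : finite_set [set: arr G].
Hypothesis rngW : forall u, W u -> exists x : arr G, rng x = u.
Implicit Types (x : arr G) (p q : newVert W) (g h : arr G -> nat).
Implicit Types (z : seq (vert (multires W))) (m : Mon G).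

Let finNV (A : set (newVert W)) : finite_set A.
Proof. exact: finite_setTT (finite_newVert W finV finA). Qed.
Let finAG (A : set (arr G)) : finite_set A.
Proof. exact: finite_setTT. Qed.

(** A function [g] on arrows stands for the formal sum of the families [thru x],
    each taken [g x] times: [sum_along g] is this sum in the free monoid on the
    new vertices, and [weight g] its value in M(G). *)
Definition sum_along g p : nat := \big[addn/0%N]_(x \in tup p) g x.
Definition weight g : Mon G :=
  \sum_(x \in rng @^-1` W) agen (src x) *+ g x.

Lemma weightE g : weight g =
  \sum_(u \in W) \sum_(x \in rng @^-1` [set u]) agen (src x) *+ g x.
Proof.
rewrite [LHS](fsbig_fibers _ _ (finAG _) (finite_setTT _ finV)
  (fun x Wx => Wx)).
apply: eq_fsbigr => u /set_mem Wu; apply: eq_fsbigl.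
apply/seteqP; split=> [x []//|x xu].
exact: conj (eq_ind_r W Wu xu) xu.
Qed.

(** The value in M(G) only depends on the sum in the free monoid. *)
Lemma weight_inj g h : sum_along g =1 sum_along h -> weight g = weight h.
Proof.
move=> gh; rewrite !weightE; apply: eq_fsbigr => u /set_mem Wu.
apply: (transversal_sum_inj finA (t := agen u)) => [X DX|Y tY].
  by rewrite (agen_blk DX).
by have [p _ <-] := newVert_ex Wu tY; apply: gh.
Qed.

(** [transversal_sum_unitary] is applied at each vertex of [W] separately. *)
Lemma sum_along_unitary (f : newVert W -> nat) g g' :
    (forall p, (f p + sum_along g p)%N = sum_along g' p) ->
  exists h, f =1 sum_along h.
Proof.
move=> fg.
have /choice[h hP] : forall u, exists h, forall p, base p = u ->
    f p = sum_along h p.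
  move=> u; have [Wu|nWu] := pselect (W u); last first.
    by exists (fun=> 0%N) => p pu; case: nWu; rewrite -pu; apply: base_in.
  have [x0 x0u] := rngW Wu.
  pose F Y := if insub (u, Y) : option (newVert W) is Some p then f p else 0%N.
  have FE p : base p = u -> F (tup p) = f p.
    move=> pu; rewrite /F.
    have -> : (u, tup p) = val p by rewrite /tup -pu /base; case: (val p).
    by rewrite valK.
  have Fg Y : transversal u Y ->
      (F Y + \big[addn/0%N]_(x \in Y) g x)%N = \big[addn/0%N]_(x \in Y) g' x.
    by move=> tY; have [p pu <-] := newVert_ex Wu tY; rewrite FE.
  have [h hP] := transversal_sum_unitary finA x0u Fg.
  exists h => p pu; rewrite -FE// hP// -pu; exact: tup_transversal.
exists (fun x => h (rng x) x) => p; rewrite (hP _ p erefl).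
by apply: eq_fsbigr => x /set_mem /tup_rng ->.
Qed.

Lemma sum_alongD g h p :
  sum_along (fun x => g x + h x)%N p = (sum_along g p + sum_along h p)%N.
Proof. exact: fsum_nD. Qed.

Lemma weightD g h : weight (fun x => g x + h x)%N = weight g + weight h.
Proof. by rewrite -fsumD//; apply: eq_fsbigr => x _; rewrite mulrnDr. Qed.

Definition indic x y : nat := `[< y = x >].

Lemma sum_along_indic x p : sum_along (indic x) p = `[< tup p x >] :> nat.
Proof.
rewrite /sum_along (@fsbig_indic _ _ _ _ _ _ x) /indic.
  by rewrite (asboolT (erefl x)); case: `[< _ >].
by move=> y _ yx; rewrite asboolF.
Qed.

Lemma weight_indic x : W (rng x) -> weight (indic x) = agen (src x).
Proof.
move=> Wx; rewrite /weight (@fsbig_indic _ _ _ _ _ _ x) /indic.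
  by rewrite !asboolT.
by move=> y _ yx; rewrite asboolF.
Qed.

Definition old_part (v : vert (multires W)) : Mon G :=
  match v with inl v => agen v | inr _ => 0 end.

Definition new_count p z : nat := count_mem (inr p : vert (multires W)) z.

Lemma new_count_cat p z z' :
  new_count p (z ++ z') = (new_count p z + new_count p z')%N.
Proof. exact: count_cat. Qed.

Lemma new_count_inl p (w : seq (vert G)) :
  new_count p [seq inl v | v <- w] = 0%N.
Proof. by apply/count_memPn/mapP => -[]. Qed.

(** A word is worth [m] if its new vertices can be gathered in families
    [thru x], and [m] is the sum of its old vertices and of the sources of the
    arrows [x] that occur. *)
Definition worth z m := exists2 g, forall p, new_count p z = sum_along g p
  & m = \sum_(v <- z) old_part v + weight g.

Lemma worth_perm z z' m : perm_eq z z' -> worth z m -> worth z' m.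
Proof.
move=> zz' [g gz ->]; exists g => [p|]; last by rewrite (perm_big _ zz').
by rewrite -gz; apply/esym/permP.
Qed.

(** When [z'] replaces the source of [x] by its new arrows, a family [thru x] is
    added. Conversely, if a family [thru x] can be removed, what remains is still
    a sum of families, by [sum_along_unitary], and its value is the expected one,
    by [weight_inj]. *)
Lemma worth_rel z z' c m : mon_rel z z' ->
  worth (z ++ c) m <-> worth (z' ++ c) m.
Proof.
case=> -[v|p] X l; last by [].
case=> [[Y DY <-]|[x [Wx <-] <-]] ul lE.
  have Fl (P : nmodType) (F : vert (multires W) -> P) :
      \sum_(v <- [seq src e | e <- l]) F v = \sum_(x \in Y) F (inl (src x)).
    by rewrite big_map fsbig_seq// -lE mr_sum_inl.
  have count0 p : new_count p [seq src e | e <- l] = 0%N.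
    apply/count_memPn/mapP => -[e el].
    have : [set` l] e by [].
    by rewrite -lE => -[y _ <-].
  have valE : \sum_(v <- [seq src e | e <- l]) old_part v = agen v.
    by rewrite Fl (agen_blk DY).
  split=> -[g gz ->]; exists g.
  - by move=> p; rewrite new_count_cat count0 -gz.
  - by rewrite [in RHS]big_cat /= valE big_cons.
  - by move=> p; rewrite -gz [RHS]new_count_cat count0.
  - by rewrite big_cat /= valE big_cons.
have count1 p : new_count p [seq src e | e <- l] = `[< tup p x >] :> nat.
  rewrite /new_count count_uniq_mem; last first.
    rewrite map_inj_in_uniq// => e e' el e'l; apply: (@mr_src_inj G W x).
      by apply/mem_set; rewrite /new_arrows lE.
    by apply/mem_set; rewrite /new_arrows lE.
  congr (nat_of_bool _); apply/mapP/asboolP => [[e el pe]|px].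
    have : (@src (multires W) @` new_arrows W x) (inr p).
      by exists e => //; rewrite /new_arrows lE.
    by rewrite mr_src_image => -[q qx [<-]].
  have [a xa ap] := newArr_ex px; exists a => //.
  by have : [set` l] a by rewrite -lE.
have val0 : \sum_(v <- [seq src e | e <- l]) old_part v = 0.
  rewrite big_map big_seq big1// => e el.
  have : new_arrows W x e by rewrite /new_arrows lE.
  by move=> [q _ <-].
split=> -[g gz ->].
  exists (fun y => g y + indic x y)%N => [p|].
    rewrite sum_alongD sum_along_indic new_count_cat count1 -gz /=; lia.
  rewrite [in RHS]big_cat /= val0 add0r weightD weight_indic// big_cons /=.
  by rewrite [RHS]addrA addrC addrA [X in X + _]addrC.
have cg p : (new_count p c + sum_along (indic x) p)%N = sum_along g p.
  by rewrite sum_along_indic -gz new_count_cat count1 addnC.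
have [h hz] := sum_along_unitary cg.
exists h => [p|]; first by rewrite /= hz.
have -> : weight g = weight (fun y => h y + indic x y)%N.
  apply: weight_inj => p; rewrite sum_alongD sum_along_indic -hz -gz.
  by rewrite new_count_cat count1 addnC.
rewrite weightD weight_indic// big_cat /= val0 add0r big_cons /=.
by rewrite addrA addrC addrA.
Qed.

(** The induction needs the invariance in all contexts [c], as congruences can be
    concatenated. *)
Lemma worth_cong z z' m : pcong (@mon_rel (multires W)) z z' ->
  worth z m <-> worth z' m.
Proof.
move=> zz'.
suff : forall c, worth (z ++ c) m <-> worth (z' ++ c) m.
  by move=> /(_ [::]); rewrite !cats0.
elim: zz' => {z z'} [z z' r c|z z' c|//|z z' _ IH c|z z' z'' _ I1 _ I2 c|].
- exact: worth_rel.
- by split; apply: worth_perm; rewrite perm_cat2r perm_catC.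
- by rewrite IH.
- by rewrite I1 I2.
move=> w w' z z' _ Iw _ Iz c.
have swap_perm (s t : seq (vert (multires W))) :
    worth ((s ++ t) ++ c) m <-> worth (t ++ (s ++ c)) m.
  by split; apply: worth_perm; rewrite ?[perm_eq (_ ++ (_ ++ _)) _]perm_sym;
     rewrite -catA perm_catCA.
by rewrite -catA Iw -swap_perm -catA Iz; split; apply: worth_perm;
   rewrite ?[perm_eq (z' ++ _) _]perm_sym -catA perm_catCA.
Qed.

Lemma worth_inl (w : seq (vert G)) :
  worth [seq inl v | v <- w] (pclass (@mon_rel G) w).
Proof.
exists (fun=> 0%N) => [p|].
  by rewrite /sum_along fsbig1// new_count_inl.
rewrite /weight fsbig1// addr0 big_map; exact: pclass_sum.
Qed.

(** Expand the source of each arrow along its new arrows, and exchange the sums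
    over the arrows and over the new vertices. *)
Lemma worth_sound (j : {additive Mon G -> Mon (multires W)}) z m :
    (forall v, j (agen v) = agen (inl v : vert (multires W))) -> worth z m ->
  pclass (@mon_rel (multires W)) z = j m.
Proof.
move=> jE [g gz ->]; rewrite pclass_sum raddfD raddf_sum /=.
have -> : j (weight g) =
    \sum_(p \in setT) agen (inr p : vert (multires W)) *+ new_count p z.
  transitivity (\sum_(x \in rng @^-1` W) \sum_(p \in thru W x)
      agen (inr p : vert (multires W)) *+ g x).
    rewrite raddf_fsum//; apply: eq_fsbigr => x /set_mem Wx.
    by rewrite raddfMn jE agen_thru// fsumMn.
  rewrite (@exchange_fsbig_dep _ _ _ _ _ _ _ setT (fun p => tup p))//.
    by apply: eq_fsbigr => p _; rewrite gz mulrn_fsum.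
  move=> x p; split=> [[_ px]//|[_ px]]; split=> //.
  exact: tup_in px.
elim: z {g gz} => [|v z IHz]; first by rewrite !big_nil fsbig1// addr0.
rewrite !big_cons IHz -addrA.
transitivity (j (old_part v) + \sum_(p \in setT)
  agen (inr p : vert (multires W)) *+ (v == inr p) +
  (\sum_(w <- z) j (old_part w) +
  \sum_(p \in setT) agen (inr p : vert (multires W)) *+ new_count p z)).
  congr (_ + _); case: v => [v|p] /=.
    by rewrite fsbig1// addr0 jE.
  rewrite raddf0 add0r (@fsbig_indic _ _ _ _ _ _ p).
    by rewrite asboolT// eqxx.
  by move=> q _ qp; case: eqP => // -[pq]; case: qp.
rewrite -!addrA; congr (_ + _); rewrite addrCA; congr (_ + _); rewrite -fsumD//.
by apply: eq_fsbigr => p _; rewrite -mulrnDr.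
Qed.

(** Being worth [m] is invariant under congruence, the image of [w] is worth the
    class of [w] and nothing else, and if [j u + v] is worth something, then so is
    [v]. *)
Lemma mr_unitary (j : {additive Mon G -> Mon (multires W)}) :
    (forall v, j (agen v) = agen (inl v : vert (multires W))) ->
  unitary_embedding j.
Proof.
move=> jE.
have jw w : j (pclass (@mon_rel G) w) =
    pclass (@mon_rel (multires W)) [seq inl v | v <- w].
  exact/esym/worth_sound/worth_inl.
split.
- move=> m m'; rewrite -(pclass_repr m) -(pclass_repr m') !jw.
  move=> /pclassP /worth_cong wE.
  have [g gz ->] := (wE _).1 (worth_inl (repr m)).
  have -> : weight g = weight (fun=> 0%N).
    apply: weight_inj => p; rewrite -gz new_count_inl.
    by rewrite /sum_along fsbig1.
  by rewrite /weight fsbig1// addr0 big_map pclass_sum.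
- have le_gen (v : vert (multires W)) : exists m, alg_le (agen v) (j m).
    case: v => [v|p]; first by exists (agen v), 0; rewrite addr0 jE.
    have [x0 x0p] := rngW (base_in p).
    have [X] := blk_cover x0; rewrite x0p => DX _.
    have [x [[Xx px] _]] := (tup_transversal p).2 X DX.
    exists (agen (src x)); exists (\sum_(q \in thru W x `\ p)
      agen (inr q : vert (multires W))).
    have Wx := tup_in px.
    rewrite jE (agen_thru finV finA Wx); symmetry; apply: fsbigD1 => //.
  move=> u; have [z ->] := MonE u.
  elim: z => [|v z [m [c mc]]].
    by exists 0, 0; rewrite raddf0 big_nil addr0.
  have [m' [c' mc']] := le_gen v; exists (m' + m), (c' + c).
  by rewrite big_cons addrACA mc mc' raddfD.
- move=> u u' v; rewrite -(pclass_repr u) -(pclass_repr u') -(pclass_repr v) !jw.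
  rewrite -pclass_cat => /pclassP /worth_cong wE.
  have [g gz _] := (wE _).2 (worth_inl (repr u')).
  exists (\sum_(v <- repr v) old_part v + weight g).
  apply: worth_sound => //; exists g => // p; rewrite -gz new_count_cat.
  by rewrite new_count_inl.
Qed.

End Embedding.

(** * The last two layers of a stage *)

(** A vertex which has no block would have one new vertex, with the empty tuple
    and a free generator; the last two conditions exclude this at all stages. *)
Definition full_stage (S : stage) :=
  [/\ finite_set [set: vert S], finite_set [set: arr S],
      forall u : vert S, lay0 u -> exists x : arr S, rng x = u
    & forall w : vert S, lay1 w -> exists2 x : arr S, layA x & src x = w].

Lemma full_next S : full_stage S -> full_stage (next_stage S).
Proof.
move=> [finV finA rng0 src1]; split.
- exact: finite_mr_vert.
- exact: finite_mr_arr.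
- move=> _ [w /src1[x lx <-] <-].
  have [p px] : exists p, thru (@lay0 S) x p.
    by apply: thru_neq0; have [] := lay_ends lx.
  have [a ax _] := newArr_ex px.
  by exists a; exact: blk_sub (mr_blk_new (tup_in px)) ax.
- move=> _ [p _ <-]; have [x0 x0p] := rng0 _ (base_in p).
  have [X] := blk_cover x0; rewrite x0p => DX _.
  have [x [[_ px] _]] := (tup_transversal p).2 X DX.
  have [a [q _ <-] ap] := newArr_ex px.
  by exists (inr q) => //; exists q.
Qed.

Lemma full_F (E : bipGraph) : finite_sepGraph E -> forall n, full_stage (F_ E n).
Proof.
move=> [finV finA]; elim=> [|n IHn]; last exact: full_next.
split=> //= [u|w]; first by rewrite -bip_rng => -[x _ <-]; exists x.
by rewrite -bip_src => -[x _ <-]; exists x.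
Qed.

Section LastLayers.
Variables (S : stage).
Hypothesis fullS : full_stage S.
Hypothesis QP : forall a : arr S, layA a ->
  (@lay0 S `|` @lay1 S) (rng a) /\ (@lay0 S `|` @lay1 S) (src a).

Notation rS := (restrict QP).

Lemma lay0_ex (u : vert S) : lay0 u -> exists x : arr S, rng x = u.
Proof. by have [_ _ + _] := fullS; apply. Qed.

Lemma lay_disj (u : vert S) : lay0 u -> ~ lay1 u.
Proof. by move=> /lay0_ex[x <-]; apply: lay_source. Qed.

Lemma finite_rs_vert : finite_set [set: vert rS].
Proof. by apply: finite_val; have [] := fullS. Qed.

Lemma finite_rs_arr : finite_set [set: arr rS].
Proof. by apply: finite_val; have [] := fullS. Qed.

Lemma rs_vert_ex (v : vert S) : (@lay0 S `|` @lay1 S) v ->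
  exists w : vert rS, val w = v.
Proof. by move=> Pv; exists (exist _ v (asboolT Pv)). Qed.

Lemma rs_arr_ex (a : arr S) : layA a -> exists b : arr rS, val b = a.
Proof. by move=> Qa; exists (exist _ a (asboolT Qa)). Qed.

Lemma rs_layA (a : arr rS) : layA (val a).
Proof. exact/asboolP/(valP a). Qed.

Lemma val_image (Y : set (arr S)) : Y `<=` (@layA S) ->
  val @` ((val : arr rS -> arr S) @^-1` Y) = Y.
Proof.
move=> YA; apply/seteqP; split=> [_ [a Ya <-] //|a Ya].
by have [b ba] := rs_arr_ex (YA _ Ya); exists b; rewrite //= ba.
Qed.

Lemma blk_layA (u : vert S) (Y : set (arr S)) : lay0 u -> blk u Y ->
  Y `<=` @layA S.
Proof. by move=> lu DY a /(blk_sub DY) au; apply: lay_full; rewrite au. Qed.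

(** Arrows into the layer [lay0] are all kept, so that no block is cut. *)
Lemma rs_blkE (v : vert rS) (X : set (arr rS)) : blk v X <->
  [/\ lay0 (val v), blk (val v) (val @` X)
    & X = (val : arr rS -> arr S) @^-1` (val @` X)].
Proof.
split=> [[[a Xa] [Y DY XY]]|[lv DY XY]].
  have lv : lay0 (val v).
    rewrite XY in Xa; rewrite -(blk_sub DY Xa).
    by have [] := lay_ends (rs_layA a).
  have YX : val @` X = Y by rewrite XY val_image//; apply: blk_layA lv DY.
  by rewrite YX.
split; last by exists (val @` X).
by have [_ [a Xa _]] := blk_neq0 DY; exists a.
Qed.

(** The junk value 0 makes this a total function on the vertices of the stage,
    which avoids carrying proofs that [v] lies in the last two layers. *)
Definition top_gen (v : vert S) : Mon rS :=
  if insub v : option (vert rS) is Some w then agen w else 0.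

Lemma top_gen_val (w : vert rS) : top_gen (val w) = agen w.
Proof. by rewrite /top_gen valK. Qed.

Lemma sum_val (R : Type) (idx : R) (op : Monoid.com_law idx)
    (X : set (arr rS)) (F : arr S -> R) :
  \big[op/idx]_(a \in X) F (val a) = \big[op/idx]_(a \in val @` X) F a.
Proof. by rewrite fsbig_image// => a b _ _; apply: val_inj. Qed.

Lemma top_gen_blk (u : vert S) (Y : set (arr S)) : lay0 u -> blk u Y ->
  top_gen u = \sum_(y \in Y) top_gen (src y).
Proof.
move=> lu DY; have [w wu] := rs_vert_ex (or_introl lu); rewrite -{u}wu in lu DY *.
have YA := blk_layA lu DY.
have DX : blk w ((val : arr rS -> arr S) @^-1` Y).
  by apply/rs_blkE; rewrite val_image.
rewrite top_gen_val (agen_blk DX); last exact: finite_setTT finite_rs_arr.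
rewrite -[in RHS](val_image YA) -sum_val.
by apply: eq_fsbigr => a _; rewrite -top_gen_val.
Qed.

Definition top_incl (kappa : Mon rS -> Mon S) :=
  forall v : vert rS, kappa (agen v) = agen (val v).

Lemma top_incl_ex : exists kappa : {additive Mon rS -> Mon S}, top_incl kappa.
Proof.
apply: Mon_lift => v X /rs_blkE[lv DY _] _.
rewrite (agen_blk DY) -?sum_val//.
by apply: finite_setTT; have [] := fullS.
Qed.

Lemma top_incl_gen (kappa : {additive Mon rS -> Mon S}) (v : vert S) :
  top_incl kappa -> (@lay0 S `|` @lay1 S) v -> kappa (top_gen v) = agen v.
Proof. by move=> kE /rs_vert_ex[w <-]; rewrite top_gen_val kE. Qed.

(** An inverse of the homomorphism induced by the inclusion of the last two
    layers: its values are prescribed at the vertices of these layers only, the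
    others being determined by the second condition. *)
Definition top_retract (rho : Mon S -> Mon rS) :=
  (forall v : vert rS, rho (agen (val v)) = agen v) /\
  forall kappa : {additive Mon rS -> Mon S}, top_incl kappa -> cancel rho kappa.

Lemma top_retractK (kappa : {additive Mon rS -> Mon S})
    (rho : {additive Mon S -> Mon rS}) :
  top_incl kappa -> top_retract rho -> cancel kappa rho.
Proof.
move=> kE [rE _].
by apply: (Mon_ext (h := rho \o kappa) (h' := idfun)) => v /=; rewrite kE rE.
Qed.

End LastLayers.

Arguments top_gen {S QP}.

(** All vertices of the first stage are in its last two layers. *)
Lemma retract_stage0 (E : bipGraph) (QP : forall a : arr (stage0 E), layA a ->
    (@lay0 (stage0 E) `|` @lay1 (stage0 E)) (rng a) /\
    (@lay0 (stage0 E) `|` @lay1 (stage0 E)) (src a)) :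
    finite_sepGraph E ->
  exists rho : {additive Mon (stage0 E) -> Mon (restrict QP)}, top_retract rho.
Proof.
move=> finE; have full0 : full_stage (stage0 E) := full_F finE 0.
have [v X DX _|rho rhoE] := @Mon_lift (stage0 E) _ (@top_gen _ QP).
  apply: top_gen_blk => //; have [x Xx] := blk_neq0 DX.
  by rewrite -(blk_sub DX Xx); have [] := @lay_ends (stage0 E) x I.
exists rho; split=> [v|kappa kE]; first by rewrite rhoE top_gen_val.
apply: (Mon_ext (h := kappa \o rho) (h' := idfun)) => v /=.
rewrite rhoE (top_incl_gen kE)//.
by have : [set: vert E] v by []; rewrite -(@bip_cover E).
Qed.

(** * From one stage to the next *)

Section NextLayers.
Variables (S : stage).
Hypothesis fullS : full_stage S.
Let S' := next_stage S.
Let fullS' : full_stage S' := full_next fullS.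
Hypothesis QP : forall a : arr S, layA a ->
  (@lay0 S `|` @lay1 S) (rng a) /\ (@lay0 S `|` @lay1 S) (src a).
Hypothesis QP' : forall a : arr S', layA a ->
  (@lay0 S' `|` @lay1 S') (rng a) /\ (@lay0 S' `|` @lay1 S') (src a).

Notation rS := (restrict QP).
Notation rS' := (restrict QP').
Notation W := (@lay0 S).
Notation V := ([set v : vert rS | lay0 (val v)]).
Notation toE' := (@top_gen S' QP').

Let finV : finite_set [set: vert S]. Proof. by have [] := fullS. Qed.
Let finA : finite_set [set: arr S]. Proof. by have [] := fullS. Qed.
Let finrV : finite_set [set: vert rS]. Proof. exact: finite_rs_vert. Qed.
Let finrA : finite_set [set: arr rS]. Proof. exact: finite_rs_arr. Qed.

Lemma top_gen_thru (x : arr S) : lay0 (rng x) ->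
  toE' (inl (src x)) = \sum_(p \in thru W x) toE' (inr p).
Proof.
move=> lx; have ll : @lay0 S' (inl (src x)).
  by exists (src x) => //; have [] := lay_ends (lay_full lx).
by rewrite (top_gen_blk fullS' _ ll (mr_blk_new lx)) mr_block_sum.
Qed.

(** The vertices of [lay1] are still in the last two layers of the next stage,
    those of [lay0] are not and have to be refined into new vertices. *)
Lemma top_step : exists tau : {additive Mon rS -> Mon rS'},
  forall v : vert rS, tau (agen v) =
    if `[< lay1 (val v) >] then toE' (inl (val v))
    else \sum_(p \in over W (val v)) toE' (inr p).
Proof.
apply: Mon_lift => v X /rs_blkE[lv DY _] _.
rewrite asboolF; last exact: lay_disj lv.
rewrite -(sum_over finV finA _ _ DY) -[RHS]/(\sum_(a \in X) (fun b : arr S =>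
  if `[< lay1 (src b) >] then toE' (inl (src b))
    else \sum_(p \in over W (src b)) toE' (inr p)) (val a)) sum_val.
apply: eq_fsbigr => x /set_mem /(blk_sub DY) xv; rewrite -{}xv in lv.
by rewrite asboolT ?top_gen_thru//; have [] := lay_ends (lay_full lv).
Qed.

(** The new vertices are in the last two layers; an older vertex is first expressed
    in the last two layers of the previous stage, then moved by [top_step]. *)
Lemma retract_next (rho : {additive Mon S -> Mon rS}) : top_retract rho ->
  exists rho' : {additive Mon S' -> Mon rS'}, top_retract rho'.
Proof.
move=> [rhoE rhoK]; have [tau tauE] := top_step.
have tau1 (w : vert rS) : lay1 (val w) -> tau (agen w) = toE' (inl (val w)).
  by move=> lw; rewrite tauE asboolT.
have [x lx|rho' [rho'l rho'r]] := @mr_lift S W finA _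
    (tau \o rho : {additive _ -> _}) (fun p => toE' (inr p)).
  have l1 : lay1 (src x) by have [] := lay_ends (lay_full lx).
  have [w wx] := rs_vert_ex QP (or_intror l1).
  by rewrite /= -wx rhoE tau1 wx// top_gen_thru.
exists rho'; split=> [v|kappa' k'E].
  rewrite -top_gen_val; have := valP v; case: (val v) => [a|p].
    move=> /asboolP[[b lb [ba]]|[q _ //]]; rewrite rho'l /=.
    rewrite {}ba in lb.
    by have [w wx] := rs_vert_ex QP (or_intror lb); rewrite -wx rhoE tau1 ?wx.
  by move=> _; rewrite rho'r.
have [j jE] := mr_incl_ex W finV finA.
have [kappa kE] := top_incl_ex fullS QP.
have k'inr p : kappa' (toE' (inr p)) = agen (inr p : vert S').
  by rewrite (top_incl_gen k'E)//; right; exists p.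
have k'tau : kappa' \o tau =1 j \o kappa.
  apply: (Mon_ext (h := kappa' \o tau) (h' := j \o kappa)) => v /=.
  rewrite tauE kE jE; case: asboolP => lv.
    by rewrite (top_incl_gen k'E)//; left; exists (val v).
  have l0 : lay0 (val v) by have /asboolP[] := valP v.
  have [x xv] := lay0_ex fullS l0.
  rewrite (agen_over finV finA l0 xv) raddf_fsum; last first.
    exact: finite_setTT (finite_newVert _ _ _).
  by apply: eq_fsbigr => p _; rewrite k'inr.
apply: (Mon_ext (h := kappa' \o rho') (h' := idfun)) => -[v|p] /=.
  by rewrite rho'l /= -[LHS]/((kappa' \o tau) _) k'tau /= rhoK.
by rewrite rho'r k'inr.
Qed.

(** The two multiresolutions have the same new vertices, since the last two layers
    contain all arrows into the vertices where they are taken. *)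
Lemma newVert_up (p : newVert V) :
  exists q : newVert W, base q = val (base p) /\ tup q = val @` tup p.
Proof.
have lp : lay0 (val (base p)) := base_in p.
have [sub one] := tup_transversal p.
have [q qu qY] : exists2 q : newVert W,
    base q = val (base p) & tup q = val @` tup p; last by exists q.
apply: newVert_ex => //; split=> [_ [a /sub au <-]|X DX].
  by rewrite /= -[rng (val a)]/(val (rng a)) au.
have XX := val_image QP (blk_layA lp DX).
have DX' : @blk rS (base p) ((val : arr rS -> arr S) @^-1` X).
  by apply/rs_blkE; rewrite XX.
have [x [[Xx px] xP]] := one _ DX'; exists (val x); split.
  by split=> //; exists x.
by move=> z [Xz [y py yz]]; rewrite -yz in Xz *; congr (val _); apply: xP.
Qed.

Lemma newVert_down (q : newVert W) :
  exists p : newVert V, base q = val (base p) /\ tup q = val @` tup p.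
Proof.
have lq : lay0 (base q) := base_in q.
have [u uq] := rs_vert_ex QP (or_introl lq).
have [sub one] := tup_transversal q.
have qA : tup q `<=` @layA S by move=> a /tup_in; apply: lay_full.
have YY := val_image QP qA.
have [p pu pY] : exists2 p : newVert V, base p = u &
    tup p = (val : arr rS -> arr S) @^-1` tup q; last first.
  by exists p; rewrite pu pY YY.
apply: newVert_ex; first by rewrite /= uq.
split=> [a /sub au|X /rs_blkE[_ DX ->]].
  by apply: val_inj; rewrite uq -au.
rewrite uq in DX; have [x [[Xx qx] xP]] := one _ DX.
case: Xx => y Xy yx; exists y; split.
  by rewrite /= -yx in qx *; split=> //; exists y.
by move=> z [Xz qz]; apply: val_inj; rewrite yx; apply: xP.
Qed.

(** The multiresolution of the last two layers only lacks the vertices of the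
    older layers, whose generators are superfluous. *)
Lemma multires_top (rho : {additive Mon S -> Mon rS}) : top_retract rho ->
  exists theta : {additive Mon S' -> Mon (multires V)},
  [/\ bijective theta,
      forall v : vert rS, theta (agen (inl (val v) : vert S')) =
        agen (inl v : vert (multires V))
    & forall q : newVert W, exists p : newVert V,
        [/\ base q = val (base p), tup q = val @` tup p
          & theta (agen (inr q : vert S')) = agen (inr p : vert (multires V))]].
Proof.
move=> [rhoE rhoK].
have /choice[up upP] := newVert_up; have /choice[dn dnP] := newVert_down.
have image_inj :
    injective (fun Y : set (arr rS) => (val : arr rS -> arr S) @` Y).
  move=> Y Z YZ; apply/seteqP; split=> a Ya.
    have : (val @` Z) (val a) by rewrite -YZ; exists a.
    by move=> [b Zb /val_inj <-].
  have : (val @` Y) (val a) by rewrite YZ; exists a.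
  by move=> [b Zb /val_inj <-].
have upK : cancel up dn.
  move=> p; have [bp tp] := upP p; have [bq tq] := dnP (up p).
  apply: newVert_eq; first by apply: val_inj; rewrite -bq.
  by apply: image_inj; rewrite -tq.
have dnK : cancel dn up.
  move=> q; have [bp tp] := dnP q; have [bq tq] := upP (dn q).
  by apply: newVert_eq; rewrite ?bq ?tq.
have up_bij (x : arr rS) : set_bij (thru V x) (thru W (val x)) up.
  split=> [p px|p q _ _|q qx]; last 1 first.
  - exists (dn q); rewrite ?dnK//.
    have [_ qE] := dnP q; move: qx; rewrite /thru /= qE => -[y py /val_inj xy].
    by rewrite -xy.
  - by rewrite /thru /=; have [_ ->] := upP p; exists x.
  - by move=> /(can_inj upK).
have [j jE] := mr_incl_ex W finV finA.
have [jV jVE] := mr_incl_ex V finrV finrA.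
have [kappa kE] := top_incl_ex fullS QP.
have [x lx|theta [thetal thetar]] := @mr_lift S W finA _
    (jV \o rho : {additive _ -> _})
    (fun q => agen (inr (dn q) : vert (multires V))).
  have [a ax] := rs_arr_ex QP (lay_full lx); rewrite -ax in lx *.
  rewrite /= -[src (val a)]/(val (src a)) rhoE jVE.
  rewrite (agen_thru finrV finrA (W := V)) ?(reindex_fsbig _ _ _ _ (up_bij a))//.
  by apply: eq_fsbigr => p _; rewrite upK.
have [x lx|eta [etal etar]] := @mr_lift rS V finrA _
    (j \o kappa : {additive _ -> _}) (fun p => agen (inr (up p) : vert S')).
  rewrite /= kE jE -[val (src x)]/(src (val x)).
  rewrite (agen_thru finV finA (W := W))//.
  by rewrite (reindex_fsbig _ _ _ _ (up_bij x)).
have thetav (v : vert rS) : theta (agen (inl (val v) : vert S')) =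
    agen (inl v : vert (multires V)).
  by rewrite thetal /= rhoE jVE.
exists theta; split=> // [|q]; last first.
  by exists (dn q); have [] := dnP q; split.
have etaj : eta \o jV =1 j \o kappa.
  apply: (Mon_ext (h := eta \o jV) (h' := j \o kappa)) => v /=.
  by rewrite jVE etal.
exists eta.
  apply: (Mon_ext (h := eta \o theta) (h' := idfun)) => -[v|q] /=.
    by rewrite thetal /= -[LHS]/((eta \o jV) _) etaj /= rhoK.
  by rewrite thetar etar dnK.
apply: (Mon_ext (h := theta \o eta) (h' := idfun)) => -[v|p] /=.
  by rewrite etal /= kE jE thetav.
by rewrite etar thetar upK.
Qed.

End NextLayers.

(** * Confluence and refinement *)

(** This serves to list two refinement steps of the same word in the same
    order. *)
Lemma perm_map_lift (A B : eqType) (f : A -> B) (w : seq B) (L : seq A) :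
  perm_eq w [seq f x | x <- L] ->
  exists2 L', perm_eq L L' & [seq f x | x <- L'] = w.
Proof.
elim: w L => [|b w IHw] L.
  by rewrite perm_sym => /perm_nilP; case: L => // _; exists [::].
move=> bw; have : b \in [seq f x | x <- L] by rewrite -(perm_mem bw) mem_head.
move=> /mapP[x xL bx]; have Lx := perm_to_rem xL.
have : perm_eq (b :: w) (b :: [seq f x | x <- rem x L]).
  by rewrite (perm_trans bw)// bx -map_cons perm_map.
rewrite perm_cons => /IHw[L' LL' <-]; exists (x :: L'); last by rewrite /= bx.
by rewrite (perm_trans Lx)// perm_cons.
Qed.

Lemma perm_cat_refinement (A : eqType) (a b c d : seq A) :
  perm_eq (a ++ b) (c ++ d) ->
  exists x y z t, [/\ perm_eq a (x ++ y), perm_eq b (z ++ t),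
                      perm_eq c (x ++ z) & perm_eq d (y ++ t)].
Proof.
elim: a c d => [|v a IHa] c d.
  by move=> bcd; exists [::], [::], c, d.
move=> vab; have : v \in c ++ d by rewrite -(perm_mem vab) mem_head.
rewrite mem_cat => /orP[vc|vd].
  have cv := perm_to_rem vc.
  have : perm_eq (v :: a ++ b) (v :: rem v c ++ d).
    by rewrite (perm_trans vab)// -cat_cons perm_cat2r.
  rewrite perm_cons => /IHa[x [y [z [t [ax bz cx dy]]]]].
  exists (v :: x), y, z, t; split=> //; first by rewrite perm_cons.
  by rewrite (perm_trans cv)// perm_cons.
have dv := perm_to_rem vd.
have : perm_eq (v :: a ++ b) (v :: c ++ rem v d).
  by rewrite (perm_trans vab)// perm_sym -cat1s perm_catCA perm_cat2l perm_sym.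
rewrite perm_cons => /IHa[x [y [z [t [ax bz cx dy]]]]].
exists x, (v :: y), z, t; split=> //.
  by rewrite perm_sym -[v :: y]cat1s perm_catCA perm_cons perm_sym.
by rewrite (perm_trans dv)// perm_cons.
Qed.

Section Confluence.
Variable G : sepGraph.
Implicit Types (v : vert G) (w a b d s t : seq (vert G)).

Definition refines_letter v s := s = [:: v] \/ mon_rel [:: v] s.

(** One parallel step of refinement. Listing in [L] the letters with their
    replacements allows to treat several letters at once: this is needed for the
    diamond property, since the words of two blocks at a letter only become equal
    when all their letters are refined. *)
Definition refines w w' := exists L : seq (vert G * seq (vert G)),
  [/\ perm_eq w (unzip1 L), perm_eq w' (flatten (unzip2 L))
    & forall p, p \in L -> refines_letter p.1 p.2].

Lemma refines_perml w a b : perm_eq a w -> refines w b -> refines a b.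
Proof.
by move=> aw [L [Lw bL LP]]; exists L; split=> //; apply: perm_trans aw Lw.
Qed.

Lemma refines_permr w a b : perm_eq b w -> refines a w -> refines a b.
Proof.
by move=> bw [L [La wL LP]]; exists L; split=> //; apply: perm_trans bw wL.
Qed.

Lemma refines_refl w : refines w w.
Proof.
exists [seq (v, [:: v]) | v <- w]; split.
- by rewrite /unzip1 -map_comp map_id.
- by rewrite /unzip2 -map_comp flatten_seq1.
- by move=> _ /mapP[v _ ->]; left.
Qed.

Lemma refines_cat w w' s s' :
  refines w w' -> refines s s' -> refines (w ++ s) (w' ++ s').
Proof.
move=> [L [wL w'L LP]] [M [sM s'M MP]]; exists (L ++ M); split.
- by rewrite /unzip1 map_cat perm_cat.
- by rewrite /unzip2 map_cat flatten_cat perm_cat.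
- by move=> p; rewrite mem_cat => /orP[/LP|/MP].
Qed.

Lemma refines_letterW v s : refines_letter v s -> refines [:: v] s.
Proof.
move=> vs; exists [:: (v, s)]; split=> //=; first by rewrite cats0.
by move=> p; rewrite inE => /eqP ->.
Qed.

Lemma refines_catI a b w : refines (a ++ b) w ->
  exists a' b', [/\ refines a a', refines b b' & perm_eq w (a' ++ b')].
Proof.
move=> [L [/perm_map_lift[M LM Mab] wL LP]].
have {}LP p : p \in M -> refines_letter p.1 p.2.
  by rewrite -(perm_mem LM); apply: LP.
exists (flatten (unzip2 (take (size a) M))), (flatten (unzip2 (drop (size a) M))).
split.
- exists (take (size a) M); split=> //; last by move=> p /mem_take /LP.
  by rewrite /unzip1 map_take Mab take_size_cat.
- exists (drop (size a) M); split=> //; last by move=> p /mem_drop /LP.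
  by rewrite /unzip1 map_drop Mab drop_size_cat.
rewrite -flatten_cat -map_cat cat_take_drop (perm_trans wL)//.
exact/perm_flatten/perm_map.
Qed.

Lemma mon_rel1 s t : mon_rel s t -> exists v, s = [:: v].
Proof. by case=> v X l _ _ _; exists v. Qed.

Lemma refines_cong w w' : refines w w' -> pcong (@mon_rel G) w w'.
Proof.
move=> [L [wL w'L LP]]; apply: pcong_trans (pcong_perm _ wL) _.
apply/pcong_sym/(pcong_trans (pcong_perm _ w'L))/pcong_sym.
elim: L LP {wL w'L} => [|[v s] L IHL] LP; first exact: pcong_refl.
rewrite /= -[v :: _]cat1s; apply: pcong_cat.
  have [/= ->|vs] := LP (v, s) (mem_head _ _); first exact: pcong_refl.
  exact: pcong_rel.
by apply: IHL => p pL; apply: LP; rewrite inE pL orbT.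
Qed.

Inductive refines_star w : seq (vert G) -> Prop :=
| refines_star0 : refines_star w w
| refines_starS w' d : refines w w' -> refines_star w' d -> refines_star w d.

Lemma refines_star_cong w d : refines_star w d -> pcong (@mon_rel G) w d.
Proof.
elim=> {w d} [w|w w' d /refines_cong ww' _]; first exact: pcong_refl.
exact: pcong_trans ww'.
Qed.

Lemma refines_star_trans w a d :
  refines_star w a -> refines_star a d -> refines_star w d.
Proof.
by elim=> // {w a} w w' a ww' _ IH /IH; apply: refines_starS.
Qed.

Lemma refines_star_cat w a s b : refines_star w a -> refines_star s b ->
  refines_star (w ++ s) (a ++ b).
Proof.
move=> wa sb; apply: (@refines_star_trans _ (a ++ s)).
  elim: wa => {w a} [w|w w' d ww' _]; first exact: refines_star0.
  by apply: refines_starS; apply: refines_cat (refines_refl s).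
elim: sb => {s b} [s|s s' d ss' _]; first exact: refines_star0.
by apply: refines_starS; apply: refines_cat (refines_refl a) _.
Qed.

Lemma refines_star_catI a b w d : perm_eq w (a ++ b) -> refines_star w d ->
  exists a' b', [/\ refines_star a a', refines_star b b' & perm_eq d (a' ++ b')].
Proof.
move=> wab wd; elim: wd a b wab => {w d} [w|w w' d ww' _ IH] a b wab.
  by exists a, b; split=> //; apply: refines_star0.
have [|a1 [b1 [aa1 bb1 w'ab]]] := @refines_catI a b w'.
  by apply: refines_perml ww'; rewrite perm_sym.
have [a' [b' [a1a' b1b' dab]]] := IH _ _ w'ab.
exists a', b'; split=> //.
  exact: refines_starS a1a'.
exact: refines_starS b1b'.
Qed.

Hypothesis diamond_letter : forall v s t,
  mon_rel [:: v] s -> mon_rel [:: v] t -> exists2 d, refines s d & refines t d.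

(** Letters can be treated one at a time, once the two steps are listed in the
    same order. *)
Lemma refines_diamond w a b : refines w a -> refines w b ->
  exists2 d, refines a d & refines b d.
Proof.
move=> [L [wL aL LP]] [M0 [wM0 bM0 M0P]].
have [M M0M LM] : exists2 M, perm_eq M0 M & unzip1 M = unzip1 L.
  by apply: perm_map_lift; rewrite (perm_trans _ wM0)// perm_sym.
have {}bM : perm_eq b (flatten (unzip2 M)).
  by rewrite (perm_trans bM0)//; apply/perm_flatten/perm_map.
have {M0P} MP p : p \in M -> refines_letter p.1 p.2.
  by rewrite -(perm_mem M0M); apply: M0P.
suff [d Ld Md] : exists2 d, refines (flatten (unzip2 L)) d &
    refines (flatten (unzip2 M)) d.
  by exists d; [apply: refines_perml Ld|apply: refines_perml Md].
elim: L M LP MP LM {w a b wL aL wM0 bM0 bM M0 M0M}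
  => [|[v s] L IHL] [|[v' t] M] //.
  by exists [::]; apply: refines_refl.
move=> LP MP [vv' LM]; rewrite {}vv' in MP *.
have [p pL|p pM|d Ld Md] := IHL M _ _ LM.
- by apply: LP; rewrite inE pL orbT.
- by apply: MP; rewrite inE pM orbT.
have [e se te] : exists2 e, refines s e & refines t e.
  have := MP _ (mem_head _ _); have := LP _ (mem_head _ _) => /=.
  move=> vs vt; case: (vs) (vt) => [->|vs'] [->|vt'].
  - by exists [:: v]; apply: refines_refl.
  - by exists t; [apply: refines_letterW|apply: refines_refl].
  - by exists s; [apply: refines_refl|apply: refines_letterW].
  - exact: diamond_letter vs' vt'.
by exists (e ++ d); apply: refines_cat.
Qed.

Lemma refines_strip w a b : refines w a -> refines_star w b ->
  exists2 d, refines_star a d & refines b d.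
Proof.
move=> wa wb; elim: wb a wa => {w b} [w|w w' b ww' _ IH] a wa.
  by exists a; first exact: refines_star0.
have [d ad w'd] := refines_diamond wa ww'.
have [e de be] := IH _ w'd.
by exists e => //; apply: refines_starS ad de.
Qed.

Lemma refines_confluent w a b : refines_star w a -> refines_star w b ->
  exists2 d, refines_star a d & refines_star b d.
Proof.
move=> wa; elim: wa b => {w a} [w|w w' a ww' _ IH] b wb.
  by exists b => //; apply: refines_star0.
have [d w'd bd] := refines_strip ww' wb.
have [e ae de] := IH _ w'd.
by exists e => //; apply: refines_starS bd de.
Qed.

(** The Church-Rosser property. *)
Lemma cong_join w w' : pcong (@mon_rel G) w w' ->
  exists2 d, refines_star w d & refines_star w' d.
Proof.
elim=> {w w'} [w w' r|w w'|w|w w' _ [d wd w'd]|w w' w'' _ [d wd w'd]|].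
- have [v wv] := mon_rel1 r; rewrite {}wv in r *.
  exists w'; last exact: refines_star0.
  apply: refines_starS (refines_star0 _); apply: refines_letterW; by right.
- exists (w' ++ w); last exact: refines_star0.
  apply: refines_starS (refines_star0 _).
  by apply: refines_perml (refines_refl _); rewrite perm_catC.
- by exists w; apply: refines_star0.
- by exists d.
- move=> _ [e w'e w''e]; have [f df ef] := refines_confluent w'd w'e.
  exists f; first exact: refines_star_trans wd df.
  exact: refines_star_trans w''e ef.
- move=> w w' z z' _ [d wd w'd] _ [e ze z'e].
  by exists (d ++ e); apply: refines_star_cat.
Qed.

(** By confluence, two equal sums have a common refinement as words, and words
    satisfy refinement. *)
Lemma confluent_refinement : refinement_monoid (Mon G).
Proof.
move=> a b c d; rewrite -(pclass_repr a) -(pclass_repr b) -(pclass_repr c).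
rewrite -(pclass_repr d) -!pclass_cat => /pclassP /cong_join[e abe cde].
have [a' [b' [aa' bb' eab]]] := refines_star_catI (perm_refl _) abe.
have [c' [d' [cc' dd' ecd]]] := refines_star_catI (perm_refl _) cde.
have [|x [y [z [t [ax bz cx dy]]]]] := @perm_cat_refinement _ a' b' c' d'.
  by rewrite -(permPl eab).
exists (pclass _ x), (pclass _ y), (pclass _ z), (pclass _ t).
have sound w w' u : refines_star w w' -> perm_eq w' u ->
    pclass (@mon_rel G) w = pclass (@mon_rel G) u.
  move=> ww' w'u; apply/pclassP/(pcong_trans (refines_star_cong ww')).
  exact: pcong_perm.
by rewrite -!pclass_cat; split; apply: sound; eassumption.
Qed.

End Confluence.

(** * Refinement in the complete multiresolution *)

Section Complete.
Variable E : bipGraph.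
Hypothesis finE : finite_sepGraph E.

Let full n : full_stage (F_ E n) := full_F finE n.

Let finV n (A : set (vert (F_ E n))) : finite_set A.
Proof. by apply: finite_setTT; have [] := full n. Qed.
Let finA n (A : set (arr (F_ E n))) : finite_set A.
Proof. by apply: finite_setTT; have [] := full n. Qed.

(** A vertex of [lay1] is in [lay0] one stage later. *)
Lemma Finf_lay0 n (w : vert (F_ E n)) :
  exists m (u : vert (F_ E m)), lay0 u /\ to_vert u = to_vert w.
Proof.
suff [lw|//] : lay1 w \/
    exists m (u : vert (F_ E m)), lay0 u /\ to_vert u = to_vert w.
  by exists n.+1, (inl w); split=> //; exists w.
elim: n w => [|n IHn] w.
  have : [set: vert E] w by [].
  rewrite -(@bip_cover E) => -[l0|l1]; last by left.
  by right; exists 0%N, w.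
case: w => [w|p]; last by left; exists p.
by right; have [lw|//] := IHn w; exists n.+1, (inl w); split=> //; exists w.
Qed.

(** The next stage only adds blocks at the vertices of [lay1], and [u] lies in
    [lay1] neither at stage [m] nor at a later stage. *)
Lemma Finf_blk_lay0 m (u : vert (F_ E m)) (X : set (arr (Finf E))) : lay0 u ->
  @blk (Finf E) (to_vert u) X ->
  exists2 Y : set (arr (F_ E m)), blk u Y & X = @to_arr E m @` Y.
Proof.
move=> lu [n [w [Y [wu DY ->]]]].
have [w' [Y' [w'w DY' ->]]] := Finf_blk_up m DY.
rewrite {}wu {w Y DY} in w'w.
elim: (m + n)%N (leq_addr n m) w' w'w Y' DY' => [|N IHN].
  rewrite leqn0 => /eqP m0; move: u lu; rewrite {}m0.
  move=> u lu w' /to_vert_inj -> Y DY.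
  by exists Y.
rewrite leq_eqVlt => /orP[/eqP mN {IHN}|].
  move: u lu; rewrite {}mN => u lu w' /to_vert_inj -> Y DY.
  by exists Y.
rewrite ltnS => mN [w|p] wu Y; last first.
  by move/esym/to_vert_lt: wu => /=; rewrite ltnNge mN.
move=> [[Z DZ <-]|[x [lx xw] _]].
  have [Y0 DY0 YZ] := IHN mN w wu Z DZ; exists Y0; rewrite // -YZ.
  by apply/seteqP; split=> [_ [_ [a Za <-] <-]|_ [a Za <-]];
    [exists a|exists (inl a) => //; exists a].
have lw : lay1 w by rewrite -xw; have [] := lay_ends (lay_full lx).
move: mN u lu wu {IHN}; rewrite leq_eqVlt => /orP[/eqP ->|mN] u lu wu.
  have wE : w = u by apply: (@to_vert_inj E N w u).
  by rewrite wE in lw; have := lay_disj (full N) lu lw.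
exfalso.
case: N mN w lw wu {Y x lx xw} => [//|N] mN _ [p _ <-] /= /esym/to_vert_lt /=.
by rewrite ltnNge -ltnS mN.
Qed.

(** One stage later, all the blocks at [u] are refined by the word [d] of the new
    vertices over [u]. Words matter up to permutation, so that [d] is described by
    its letter counts. *)
Lemma Finf_block_refines m (u : vert (F_ E m)) (s : seq (vert (Finf E))) :
    lay0 u -> mon_rel [:: to_vert u : vert (Finf E)] s ->
  exists2 d, refines s d &
    forall t : vert (Finf E), count_mem t d =
      \big[addn/0%N]_(p \in over (@lay0 (F_ E m)) u)
        (@to_vert E m.+1 (inr p) == t : nat).
Proof.
move=> lu r.
case: {-1}_ {-1}_ / r (erefl [:: to_vert u : vert (Finf E)]) (erefl s).
move=> v X l DX ul Xl [uv] _; rewrite -{v}uv in DX *.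
have [Y DY XY] := Finf_blk_lay0 lu DX.
pose W := @lay0 (F_ E m).
have new (x : arr (F_ E m)) : Y x -> exists s,
    mon_rel [:: src (to_arr x : arr (Finf E))] s /\
    forall t, count_mem t s =
      \big[addn/0%N]_(p \in thru W x) (@to_vert E m.+1 (inr p) == t : nat).
  move=> Yx; have lx : lay0 (rng x) by rewrite (blk_sub DY Yx).
  have finZ : finite_set (@to_arr E m.+1 @` new_arrows W x).
    by apply: finite_image; apply: (@finA m.+1).
  have [k uk kE] := finite_set_enum finZ.
  exists [seq @src (Finf E) a | a <- k]; split.
    apply: (@MonRel (Finf E) _ (@to_arr E m.+1 @` new_arrows W x)) => //.
    exists m.+1, (inl (src x)), (new_arrows W x); split=> //.
      by rewrite /= Finf_srcE.
    exact: mr_blk_new.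
  move=> t; rewrite count_map -sum1_count.
  rewrite big_mkcond /= fsbig_seq// -kE fsbig_image; last first.
    by move=> a b _ _; apply: to_arr_inj.
  rewrite -(mr_block_sum _ x
    (fun v => (@to_vert E m.+1 v == t : nat))).
  apply: eq_fsbigr => a _.
  by rewrite (@Finf_srcE E m.+1 a); case: eqP.
have /choice[f fP] : forall e : arr (Finf E), exists s, X e ->
    mon_rel [:: src e] s /\ forall x, to_arr x = e -> forall t, count_mem t s =
      \big[addn/0%N]_(p \in thru W x) (@to_vert E m.+1 (inr p) == t : nat).
  move=> e; have [|nXe] := pselect (X e); last by exists [::].
  rewrite {1}XY => -[x Yx xe]; have [s0 [rs0 cs0]] := new x Yx.
  by exists s0 => _; rewrite -xe; split=> // y /to_arr_inj ->.
exists (flatten [seq f e | e <- l]).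
  exists [seq (src e, f e) | e <- l]; split.
  - by rewrite /unzip1 -map_comp.
  - by rewrite /unzip2 -map_comp.
  - move=> _ /mapP[e el ->]; right.
    have Xe : X e by rewrite Xl.
    by have [] := fP _ Xe.
move=> t; rewrite count_flatten -map_comp sumnE big_map fsbig_seq// -Xl {1}XY.
rewrite fsbig_image; last by move=> a b _ _; apply: to_arr_inj.
rewrite -(sum_over (@finV m setT) (@finA m setT) _ _ DY).
apply: eq_fsbigr => x /set_mem Yx /=.
have Xx : X (to_arr x) by rewrite XY; exists x.
by have [_ /(_ x erefl) ->] := fP _ Xx.
Qed.

(** The word of the new vertices over [u] does not depend on the block chosen at
    [u], whence the diamond property. *)
Lemma Finf_refinement : refinement_monoid (Mon (Finf E)).
Proof.
apply: confluent_refinement => v s t vs vt.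
have [n [w wv]] : exists n (w : vert (F_ E n)), to_vert w = v.
  case: (v) => [w|[n p]]; first by exists 0%N, w.
  by exists n.+1, (inr p).
have [m [u [lu uw]]] := Finf_lay0 w; rewrite wv in uw; rewrite -uw in vs vt.
have [d sd dE] := Finf_block_refines lu vs.
have [e te eE] := Finf_block_refines lu vt.
exists d => //; apply: refines_permr te; apply/allP => x _ /=.
by rewrite dE eE.
Qed.

End Complete.

(** * Extending homomorphisms into refinement monoids *)

Section RefinementMonoid.
Variable P : nmodType.
Hypothesis refP : refinement_monoid P.

Lemma refine_vector (J : eqType) (j0 : J) (s : seq J) (b : J -> P) x y :
    uniq (j0 :: s) -> x + y = \sum_(j <- j0 :: s) b j ->
  exists b1 b2 : J -> P, [/\ \sum_(j <- j0 :: s) b1 j = x,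
    \sum_(j <- j0 :: s) b2 j = y &
    forall j, j \in j0 :: s -> b1 j + b2 j = b j].
Proof.
elim: s j0 x y => [|j1 s IHs] j0 x y.
  rewrite big_seq1 => _ xy; exists (fun=> x), (fun=> y); rewrite !big_seq1.
  by split=> // j; rewrite inE => /eqP ->.
rewrite cons_uniq big_cons => /andP[j0s us].
move=> /refP[p [q [r [t [-> -> bj0 /esym bs]]]]].
have [b1 [b2 [b1q b2t b12]]] := IHs _ _ _ us bs.
pose ext z c j := if j == j0 then z else c j : P.
have extE z c : \sum_(j <- j1 :: s) ext z c j = \sum_(j <- j1 :: s) c j.
  rewrite !big_seq; apply: eq_bigr => j js; rewrite /ext; case: eqP => // jj0.
  by rewrite -jj0 js in j0s.
exists (ext p b1), (ext r b2).
have extS z c : \sum_(j <- [:: j0, j1 & s]) ext z c j =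
    z + \sum_(j <- j1 :: s) c j.
  by rewrite big_cons extE /ext eqxx.
rewrite !extS b1q b2t; split=> // j; rewrite /ext.
by rewrite inE; case: eqP => [->|_ /b12].
Qed.

(** The rows are peeled off one at a time by [refine_vector]. The families must not
    be empty: if [P] is not conical, a sum may vanish without its terms being
    zero. *)
Lemma refine_matrix_seq (I J : eqType) i0 (s : seq I) j0 (r : seq J)
    (a : I -> P) (b : J -> P) :
    uniq (i0 :: s) -> uniq (j0 :: r) ->
    \sum_(i <- i0 :: s) a i = \sum_(j <- j0 :: r) b j ->
  exists d : I -> J -> P,
    (forall i, i \in i0 :: s -> \sum_(j <- j0 :: r) d i j = a i) /\
    (forall j, j \in j0 :: r -> \sum_(i <- i0 :: s) d i j = b j).
Proof.
move=> + ur; elim: s i0 a b => [|i1 s IHs] i0 a b.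
  rewrite big_seq1 => _ ab; exists (fun=> b); split=> [i|j _].
    by rewrite inE => /eqP ->.
  by rewrite big_seq1.
rewrite cons_uniq big_cons => /andP[i0s us].
move=> /(refine_vector ur)[b1 [b2 [b1a b2a b12]]].
have [d [dr dc]] := IHs _ _ _ us (esym b2a).
exists (fun i j => if i == i0 then b1 j else d i j); split=> [i|j jr].
  by rewrite inE; case: eqP => [->|_ /dr].
rewrite big_cons eqxx -b12//; congr (_ + _); rewrite -dc// !big_seq.
apply: eq_bigr => i is_; case: eqP => // ii0; by rewrite -ii0 is_ in i0s.
Qed.

Lemma refine_matrix (I J : choiceType) (A : set I) (B : set J)
    (a : I -> P) (b : J -> P) :
    finite_set A -> finite_set B -> A !=set0 -> B !=set0 ->
    \sum_(i \in A) a i = \sum_(j \in B) b j ->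
  exists d : I -> J -> P, (forall i, A i -> \sum_(j \in B) d i j = a i) /\
                          (forall j, B j -> \sum_(i \in A) d i j = b j).
Proof.
move=> /finite_set_enum[[|i0 s] us ->]; first by move=> _ [].
move=> /finite_set_enum[[|j0 r] ur ->]; first by move=> _ [].
move=> _ _; rewrite -!fsbig_seq// => /(refine_matrix_seq us ur)[d [dr dc]].
by exists d; split=> [i|j] /=; rewrite -?fsbig_seq//; [apply: dr|apply: dc].
Qed.

Section Selections.
Variable A : choiceType.
Hypothesis finA : finite_set [set: A].
Variables (f : A -> P) (t : P).

(** Transversals of an arbitrary list of sets, which allow an induction on the
    list. *)
Definition selection (L : seq (set A)) (Y : set A) : Prop :=
  (forall y, Y y -> exists2 X, X \in L & X y) /\
  (forall X, X \in L -> exists! x, (X `&` Y) x).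

Let fin (X : set A) : finite_set X. Proof. exact: finite_setTT. Qed.
Let fin2 (X : set (set A)) : finite_set X.
Proof. exact: finite_setTT (finite_powerset finA). Qed.

(** By induction on the number of sets. The common refinement [c] of the first
    ones and the decomposition given by [X] have the same sum [t]; a matrix with
    these margins, indexed by [X] and by the selections, refines both. *)
Lemma refine_selections (L : seq (set A)) : uniq L ->
    (forall X Y x, X \in L -> Y \in L -> X x -> Y x -> X = Y) ->
    (forall X, X \in L -> X !=set0 /\ \sum_(x \in X) f x = t) ->
  selection L !=set0 /\
  exists c : set A -> P, \sum_(Y \in selection L) c Y = t /\
    forall X x, X \in L -> X x ->
      \sum_(Y \in [set Y | selection L Y /\ Y x]) c Y = f x.
Proof.
elim: L => [|X L IHL] /= => [_ _ _|/andP[XL uL] triv XP].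
  have sel0 : selection [::] = [set set0].
    apply/seteqP; split=> [Y [Y0 _]|_ ->]; last by split.
    by apply/seteqP; split=> // y /Y0[].
  rewrite sel0; split; first by exists set0.
  by exists (fun=> t); rewrite fsbig_set1.
have LX Z : Z \in L -> Z \in X :: L by rewrite inE orbC => ->.
have [|Z ZL|[Y0 selY0] [c [ct cf]]] := IHL uL.
- by move=> Y Z x /LX YL /LX; apply: triv.
- exact/XP/LX.
have X_in : X \in X :: L by rewrite mem_head.
have [X0 Xt] := XP X X_in.
have disj Y x : selection L Y -> X x -> ~ Y x.
  move=> [YL _] Xx /YL[Z ZL Zx].
  by rewrite (triv _ _ _ X_in (LX _ ZL) Xx Zx) ZL in XL.
have addP x Y : X x -> selection L Y -> selection (X :: L) (x |` Y).
  move=> Xx selY; have [YL oneY] := selY; split=> [y [->|/YL[Z ZL Zy]]|Z].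
  - by exists X.
  - by exists Z => //; apply: LX.
  - rewrite inE => /orP[/eqP ->|ZL].
      exists x; split=> [|y [Xy [->//|Yy]]]; first by split=> //; left.
      by have := disj _ _ selY Xy.
    have [y [[Zy Yy] yP]] := oneY Z ZL; exists y; split.
      by split=> //; right.
    move=> z [Zz [zx|Yz]]; last exact: yP.
    rewrite zx in Zz; case/negP: XL.
    by rewrite (triv _ _ _ X_in (LX _ ZL) Xx Zz).
split.
  by have [x0 Xx0] := X0; exists (x0 |` Y0); apply: addP.
have [d [dr dc]] : exists d : A -> set A -> P,
    (forall x, X x -> \sum_(Y \in selection L) d x Y = f x) /\
    (forall Y, selection L Y -> \sum_(x \in X) d x Y = c Y).
  by apply: refine_matrix => //; [exists Y0|rewrite Xt ct].
pose Q := X `*` selection L.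
(* [q] is determined by its image [Z], but summing over all the [q] that give [Z]
   spares the proof of it. *)
exists (fun Z => \sum_(q \in [set q | Q q /\ q.1 |` q.2 = Z]) d q.1 q.2).
have finQ (R : set (A * set A)) : finite_set R.
  by apply: finite_setTT; rewrite -setXTT; apply: finite_setX => //; apply: fin2.
split.
  rewrite -(fsbig_fibers _ _ (finQ Q)) => [||[x Y] [Xx selY]]//; last exact: addP.
  by rewrite -pair_fsbig// -Xt; apply: eq_fsbigr => x /set_mem /dr.
move=> Z x ZXL Zx.
have -> : \sum_(Y \in [set Y | selection (X :: L) Y /\ Y x])
      \sum_(q \in [set q | Q q /\ q.1 |` q.2 = Y]) d q.1 q.2 =
    \sum_(q \in [set q | Q q /\ (q.1 |` q.2) x]) d q.1 q.2.
  rewrite [RHS](@fsbig_fibers _ _ _ _ _ _ [set Y | selection (X :: L) Y /\ Y x]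
    (fun q => q.1 |` q.2))//; last first.
    by move=> [y Y] [[Xy selY] xyY]; split=> //; apply: addP.
  apply: eq_fsbigr => Y /set_mem[selY Yx]; apply: eq_fsbigl.
  apply/seteqP; split=> [q [Qq qY]|q [[Qq _] qY]]; split=> //.
  by split; rewrite // qY.
move: ZXL; rewrite inE => /orP[/eqP ZX|ZL].
  rewrite {}ZX in Zx.
  have -> : [set q | Q q /\ (q.1 |` q.2) x] = [set x] `*` selection L.
    apply/seteqP; split=>
      [[y Y] [[Xy selY] [/= ->|/= Yx]]|[y Y] [/= -> selY]] //.
      by have := disj _ _ selY Zx.
    by split=> //; left.
  by rewrite -pair_fsbig// fsbig_set1 dr.
have -> : [set q | Q q /\ (q.1 |` q.2) x] =
    X `*` [set Y | selection L Y /\ Y x].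
  apply/seteqP; split=>
    [[y Y] [[/= Xy selY] [/= xy|/= Yx]]|[y Y] [/= Xy [selY Yx]]].
  - rewrite -xy in Xy; case/negP: XL.
    by rewrite (triv _ _ _ X_in (LX _ ZL) Xy Zx).
  - by split.
  - by split=> //; right.
rewrite -pair_fsbig// exchange_fsbig// -(cf Z x ZL Zx).
by apply: eq_fsbigr => Y /set_mem[/dc].
Qed.

End Selections.

Section Extension.
Variables (G : sepGraph) (W : set (vert G)).
Hypothesis finV : finite_set [set: vert G].
Hypothesis finA : finite_set [set: arr G].

(** The values at the new vertices over [u] are a common refinement of the
    decompositions of [h a_u] given by the blocks at [u]. *)
Lemma mr_extend (h : {additive Mon G -> P}) :
  exists h' : {additive Mon (multires W) -> P},
    forall v, h' (agen (inl v : vert (multires W))) = h (agen v).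
Proof.
have /choice[c cP] : forall u, exists c : set (arr G) -> P,
    forall x, rng x = u ->
    \sum_(Y \in [set Y | transversal u Y /\ Y x]) c Y = h (agen (src x)).
  move=> u; have [L uL LE] : exists2 L, uniq L & blk u = [set` L].
    apply: finite_set_enum; apply: finite_setTT; exact: finite_powerset.
  have inL X : X \in L <-> blk u X by rewrite LE.
  have selE : selection L = transversal u.
    apply/seteqP; split=> [Y [YL oneY]|Y [Yu oneY]]; split.
    - by move=> y /YL[X /inL DX Xy]; apply: blk_sub DX Xy.
    - by move=> X /inL; apply: oneY.
    - by move=> y /Yu yu; have [X] := blk_cover y; rewrite yu => /inL; exists X.
    - by move=> X /inL; apply: oneY.
  have [|X /inL DX|_ [c [_ cP]]] :=
      @refine_selections _ finA (fun x => h (agen (src x))) (h (agen u)) L uL.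
  - by move=> X Y x /inL DX /inL DY; apply: blk_uniq DX DY.
  - split; first exact: blk_neq0 DX.
    by rewrite (agen_blk DX) ?raddf_fsum//; exact: finite_setTT.
  exists c => x xu; have [X] := blk_cover x; rewrite xu => /inL XL Xx.
  by rewrite -selE; apply: cP XL Xx.
have [|h' [h'E _]] := @mr_lift G W finA P h (fun p => c (base p) (tup p)).
  move=> x Wx; rewrite -(cP _ x erefl).
  rewrite (reindex_fsbig (@tup G W) (thru W x)); last first.
    split.
    - move=> p px; split=> //; rewrite (tup_rng px); exact: tup_transversal.
    - move=> p q /set_mem px /set_mem qx; apply: newVert_eq.
      by rewrite -(tup_rng px) (tup_rng qx).
    - move=> Y [tY Yx]; have [p _ pY] := newVert_ex Wx tY.
      by exists p; rewrite // /thru /= pY.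
  by apply: eq_fsbigr => p /set_mem /tup_rng ->.
by exists h'.
Qed.

End Extension.
End RefinementMonoid.

(** * The complete multiresolution as a colimit *)

Section CompleteMaps.
Variable E : bipGraph.
Hypothesis finE : finite_sepGraph E.

Let full n : full_stage (F_ E n) := full_F finE n.
Let finV n : finite_set [set: vert (F_ E n)]. Proof. by have [] := full n. Qed.
Let finA n : finite_set [set: arr (F_ E n)]. Proof. by have [] := full n. Qed.
Let rng0 n (u : vert (F_ E n)) : lay0 u -> exists x : arr (F_ E n), rng x = u.
Proof. by have [_ _ + _] := full n; apply. Qed.

Lemma stage_incl_ex n : exists j : {additive Mon (F_ E n) -> Mon (F_ E n.+1)},
  forall v, j (agen v) = agen (inl v : vert (F_ E n.+1)).
Proof. exact: mr_incl_ex. Qed.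

Lemma Finf_sum n (X : set (arr (F_ E n))) (P : nmodType)
    (g : vert (Finf E) -> P) :
  \sum_(a \in @to_arr E n @` X) g (@src (Finf E) a) =
  \sum_(a \in X) g (to_vert (src a)).
Proof.
rewrite fsbig_image; last by move=> a b _ _; apply: to_arr_inj.
by apply: eq_fsbigr => a _; rewrite [src _]Finf_srcE.
Qed.

Lemma Finf_incl_ex n : exists k : {additive Mon (F_ E n) -> Mon (Finf E)},
  forall v, k (agen v) = agen (to_vert v : vert (Finf E)).
Proof.
apply: Mon_lift => v X DX finX.
have DX' : @blk (Finf E) (to_vert v) (@to_arr E n @` X) by exists n, v, X.
by rewrite (agen_blk DX') ?Finf_sum//; apply: finite_image.
Qed.

(** Every vertex and every block of F_oo comes from some F_n: this is the
    universal property of the colimit of the M(F_n). *)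
Lemma Finf_lift (P : nmodType) (h : forall n, {additive Mon (F_ E n) -> P}) :
    (forall n v, h n.+1 (agen (inl v : vert (F_ E n.+1))) = h n (agen v)) ->
  exists k : {additive Mon (Finf E) -> P},
    forall n v, k (agen (to_vert v : vert (Finf E))) = h n (agen v).
Proof.
move=> hS.
pose g (v : vert (Finf E)) : P := match v with
  | inl v => h 0%N (agen v)
  | inr p => h (tag p).+1 (agen (inr (tagged p) : vert (F_ E (tag p).+1))) end.
have gE n (v : vert (F_ E n)) : g (to_vert v) = h n (agen v).
  by elim: n v => [//|n IHn] [v|p] //=; rewrite IHn -hS.
have [_ X [n [v [Y [<- DY ->]]]] _|k kE] := @Mon_lift (Finf E) P g.
  rewrite Finf_sum gE (agen_blk DY) ?raddf_fsum; try exact: finite_setTT.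
  by apply: eq_fsbigr => a _; rewrite gE.
by exists k => n v; rewrite kE gE.
Qed.

Lemma stage_cong_up n N (u u' : seq (vert (F_ E n))) : (n <= N)%N ->
    pcong (@mon_rel (F_ E n)) u u' ->
  exists w w' : seq (vert (F_ E N)),
  [/\ [seq to_vert v | v <- w] = [seq to_vert v | v <- u],
      [seq to_vert v | v <- w'] = [seq to_vert v | v <- u']
    & pcong (@mon_rel (F_ E N)) w w'].
Proof.
elim: N => [|N IHN].
  by rewrite leqn0 => /eqP n0; move: u u'; rewrite n0 => u u' uu'; exists u, u'.
rewrite leq_eqVlt => /orP[/eqP nN {IHN}|nN uu'].
  by move: u u'; rewrite nN => u u' uu'; exists u, u'.
have [w [w' [wu w'u' /pclassP ww']]] := IHN nN uu'.
exists [seq inl v | v <- w], [seq inl v | v <- w']; split.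
- by rewrite -map_comp -wu.
- by rewrite -map_comp -w'u'.
have [j jE] := stage_incl_ex N.
apply/pclassP; have := congr1 j ww'.
by rewrite !pclass_sum !raddf_sum !big_map => jw;
  under eq_bigr do rewrite -[pgen _ _]/(agen _) -jE;
  under [RHS]eq_bigr do rewrite -[pgen _ _]/(agen _) -jE.
Qed.

(** A derivation of a congruence is finite, hence takes place at one stage. *)
Lemma Finf_cong_stage (w w' : seq (vert (Finf E))) :
    pcong (@mon_rel (Finf E)) w w' ->
  exists n (u u' : seq (vert (F_ E n))),
  [/\ [seq to_vert v | v <- u] = w, [seq to_vert v | v <- u'] = w'
    & pcong (@mon_rel (F_ E n)) u u'].
Proof.
have vert_stage (v : vert (Finf E)) : exists n (u : vert (F_ E n)), to_vert u = v.
  case: v => [v|[n p]]; first by exists 0%N, v.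
  by exists n.+1, (inr p).
have cat_stage (w1 w1' w2 w2' : seq (vert (Finf E))) :
    (exists n (u u' : seq (vert (F_ E n))),
      [/\ [seq to_vert v | v <- u] = w1, [seq to_vert v | v <- u'] = w1'
        & pcong (@mon_rel (F_ E n)) u u']) ->
    (exists n (u u' : seq (vert (F_ E n))),
      [/\ [seq to_vert v | v <- u] = w2, [seq to_vert v | v <- u'] = w2'
        & pcong (@mon_rel (F_ E n)) u u']) ->
  exists N (u u' t t' : seq (vert (F_ E N))),
    [/\ [seq to_vert v | v <- u] = w1, [seq to_vert v | v <- u'] = w1',
        [seq to_vert v | v <- t] = w2, [seq to_vert v | v <- t'] = w2'
      & pcong (@mon_rel (F_ E N)) u u' /\ pcong (@mon_rel (F_ E N)) t t'].
  move=> [n [u [u' [<- <- uu']]]] [m [t [t' [<- <- tt']]]].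
  have [a [a' [? ? ?]]] := stage_cong_up (leq_maxl n m) uu'.
  have [b [b' [? ? ?]]] := stage_cong_up (leq_maxr n m) tt'.
  by exists (maxn n m), a, a', b, b'.
have word_stage (s : seq (vert (Finf E))) :
    exists n (u u' : seq (vert (F_ E n))),
    [/\ [seq to_vert v | v <- u] = s, [seq to_vert v | v <- u'] = s
      & pcong (@mon_rel (F_ E n)) u u'].
  elim: s => [|v s IHs].
    by exists 0%N, [::], [::]; split=> //; apply: pcong_refl.
  have [n [u uv]] := vert_stage v.
  have [|N [a [_ [t [_ [av _ ts _ _]]]]]] := cat_stage [:: v] [:: v] _ _ _ IHs.
    by exists n, [:: u], [:: u]; split; rewrite /= ?uv//; apply: pcong_refl.
  by exists N, (a ++ t), (a ++ t); rewrite map_cat av ts; split=> //;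
    apply: pcong_refl.
elim=> {w w'} [w w' [v X l DX ul XL]|w w'|//
  |w w' _ [n [u [u' [wu wu' uu']]]]|w w' w'' _ I1 _ I2|].
- move: DX => [n [u [Y [uv DY XY]]]].
  have [k uk kE] : exists2 k, uniq k & Y = [set` k].
    by apply: finite_set_enum; apply: finite_setTT.
  have lk : perm_eq l [seq to_arr a | a <- k].
    apply: uniq_perm; rewrite ?map_inj_uniq//; first exact: to_arr_inj.
    move=> a; apply/idP/idP => [al|/mapP[b bk ->]].
      have : X a by rewrite XL.
      by rewrite XY kE => -[b bk <-]; apply: map_f.
    have : X (to_arr b) by rewrite XY; exists b; rewrite // kE.
    by rewrite XL.
  have [k' kk' k'l] := perm_map_lift lk.
  exists n, [:: u], [seq src a | a <- k']; split.
  - by rewrite /= uv.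
  - by rewrite -k'l -!map_comp; apply: eq_map => a /=; rewrite [RHS]Finf_srcE.
  - apply: pcong_rel; apply: MonRel DY _ _; first by rewrite -(perm_uniq kk').
    by rewrite kE; apply/seteqP; split=> a /=; rewrite (perm_mem kk').
- have [n [u [_ [uw _ _]]]] := word_stage (w ++ w').
  exists n, u, (drop (size w) u ++ take (size w) u); split=> //.
    by rewrite map_cat map_drop map_take uw drop_size_cat// take_size_cat.
  by rewrite -{1}(cat_take_drop (size w) u); apply: pcong_comm.
- by exists n, u', u; split=> //; apply: pcong_sym.
- have [N [a [a' [b [b' [<- aw' bw' <- [aa' bb']]]]]]] := cat_stage _ _ _ _ I1 I2.
  have ab : a' = b by apply: (inj_map (@to_vert_inj E N)); rewrite aw' bw'.
  by exists N, a, b'; split=> //; apply: pcong_trans aa' _; rewrite ab.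
- move=> w w' z z' _ I1 _ I2.
  have [N [a [a' [b [b' [<- <- <- <- [aa' bb']]]]]]] := cat_stage _ _ _ _ I1 I2.
  exists N, (a ++ b), (a' ++ b'); rewrite !map_cat; split=> //.
  exact: pcong_cat.
Qed.

Lemma stage_incl_unitary n (j : {additive Mon (F_ E n) -> Mon (F_ E n.+1)}) :
    (forall v, j (agen v) = agen (inl v : vert (F_ E n.+1))) ->
  unitary_embedding j.
Proof. by apply: mr_unitary => //; apply: rng0. Qed.

Fixpoint stage_up n (v : vert E) : vert (F_ E n) :=
  if n is n.+1 then inl (stage_up n v) : vert (F_ E n.+1) else v.

Lemma to_vert_up n (v : vert E) : to_vert (stage_up n v) = inl v.
Proof. by elim: n. Qed.

Lemma stage_up_unitary n : exists2 h : {additive Mon E -> Mon (F_ E n)},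
  forall v, h (agen v) = agen (stage_up n v) & unitary_embedding h.
Proof.
elim: n => [|n [h hE hU]].
  exists idfun => //; apply: (@unitary_bij _ _ idfun).
  exact: (Bijective (g := idfun)).
have [j jE] := stage_incl_ex n.
exists (j \o h : {additive _ -> _}) => [v|]; first by rewrite /= hE jE.
exact: unitary_comp (stage_incl_unitary jE).
Qed.

(** Each of the three properties concerns finitely many words of F_oo, which come
    from one stage n; there, M(E) -> M(F_n) is a composite of unitary
    embeddings. *)
Lemma Finf_unitary (h : {additive Mon E -> Mon (Finf E)}) :
    (forall v, h (agen v) = agen (inl v : vert (Finf E))) ->
  unitary_embedding h.
Proof.
move=> hE.
have stageE n (k : {additive Mon (F_ E n) -> Mon (Finf E)})
    (g : {additive Mon E -> Mon (F_ E n)}) :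
    (forall v, k (agen v) = agen (to_vert v : vert (Finf E))) ->
    (forall v, g (agen v) = agen (stage_up n v)) -> k \o g =1 h.
  move=> kE gE; apply: (Mon_ext (h := k \o g)) => v /=.
  by rewrite gE kE to_vert_up hE.
have wordE n (k : {additive Mon (F_ E n) -> Mon (Finf E)}) u :
    (forall v, k (agen v) = agen (to_vert v : vert (Finf E))) ->
    k (pclass _ u) = pclass _ [seq to_vert v | v <- u].
  move=> kE; rewrite !pclass_sum raddf_sum big_map.
  by apply: eq_bigr => v _; rewrite [LHS]kE.
have upE n (g : {additive Mon E -> Mon (F_ E n)}) w :
    (forall v, g (agen v) = agen (stage_up n v)) ->
    g (pclass _ w) = pclass _ [seq stage_up n v | v <- w].
  move=> gE; rewrite !pclass_sum raddf_sum big_map.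
  by apply: eq_bigr => v _; rewrite [LHS]gE.
have hw w : h (pclass _ w) = pclass _ [seq inl v | v <- w].
  rewrite !pclass_sum raddf_sum big_map.
  by apply: eq_bigr => v _; rewrite [LHS]hE.
have lift n (u : seq (vert (F_ E n))) w :
    [seq to_vert v | v <- u] = [seq inl v | v <- w] :> seq (vert (Finf E)) ->
    u = [seq stage_up n v | v <- w].
  move=> uw; apply: (inj_map (@to_vert_inj E n)); rewrite uw -map_comp.
  by apply: eq_map => v /=; rewrite to_vert_up.
split.
- move=> x y; rewrite -(pclass_repr x) -(pclass_repr y) !hw => /pclassP.
  move=> /Finf_cong_stage[n [u [u' [/lift -> /lift -> /pclassP uu']]]].
  have [g gE [gI _ _]] := stage_up_unitary n.
  by apply: gI; rewrite !upE.
- move=> x; have := pcong_refl (@mon_rel (Finf E)) (repr x).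
  move=> /Finf_cong_stage[n [u [_ [ux _ _]]]].
  have [g gE [_ gC _]] := stage_up_unitary n.
  have [k kE] := Finf_incl_ex n.
  have [v [c ucv]] := gC (pclass _ u); exists v, (k c).
  rewrite -(pclass_repr x) -ux -(wordE n k _ kE) -raddfD ucv.
  by rewrite -(stageE n k g kE gE).
- move=> x y z; rewrite -(pclass_repr x) -(pclass_repr y) -(pclass_repr z).
  rewrite !hw -pclass_cat => /pclassP.
  move=> /Finf_cong_stage[n [u [u' [uxz /lift -> /pclassP uu']]]].
  have [g gE [_ _ gU]] := stage_up_unitary n.
  have [k kE] := Finf_incl_ex n.
  pose u1 := take (size (repr x)) u; pose u2 := drop (size (repr x)) u.
  have u1x : u1 = [seq stage_up n v | v <- repr x].
    by apply: lift; rewrite map_take uxz take_size_cat ?size_map.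
  have u2z : [seq to_vert v | v <- u2] = repr z.
    by rewrite map_drop uxz drop_size_cat ?size_map.
  have [|w u2w] := gU (pclass _ (repr x)) (pclass _ (repr y)) (pclass _ u2).
    by rewrite !upE// -uu' -u1x -pclass_cat cat_take_drop.
  by exists w; rewrite -u2z -(wordE n k _ kE) u2w -(stageE n k g kE gE).
Qed.

Lemma Finf_universal (P : nmodType) (psi : {additive Mon E -> P}) :
    refinement_monoid P ->
  exists k : {additive Mon (Finf E) -> P},
    forall v, k (agen (inl v : vert (Finf E))) = psi (agen v).
Proof.
move=> refP.
have ext n (h : {additive Mon (F_ E n) -> P}) :
    exists h' : {additive Mon (F_ E n.+1) -> P},
    forall v, h' (agen (inl v : vert (F_ E n.+1))) = h (agen v).
  exact: mr_extend.
pose h := fix h n : {additive Mon (F_ E n) -> P} :=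
  match n with 0%N => psi | n.+1 => projT1 (cid (ext n (h n))) end.
have [|k kE] := @Finf_lift P h.
  by move=> n v; rewrite /=; case: cid.
by exists k => v; rewrite (kE 0%N).
Qed.

End CompleteMaps.

(** * The direct limit of the canonical sequence *)

Section DirectLimit.
Variables (M : nat -> nmodType) (f : forall n, {additive M n -> M n.+1}).

Lemma to_dirlim_additive n : nmod_morphism (@to_dirlim M f n).
Proof.
split=> [|x y]; first exact/pclassP/pcong_rel/lim_rel0.
rewrite -[RHS](pclass_cat (lim_rel f) [:: lim_elt x] [:: lim_elt y]).
exact/pclassP/pcong_rel/lim_relD.
Qed.

HB.instance Definition _ n := Algebra.isNmodMorphism.Build (M n) (dirlim f)
  (@to_dirlim M f n) (@to_dirlim_additive n).

Lemma to_dirlimS n (x : M n) : to_dirlim f (f n x) = to_dirlim f x.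
Proof. by apply/esym/pclassP/pcong_rel/lim_relS. Qed.

Lemma dirlim_lift (P : nmodType) (h : forall n, {additive M n -> P}) :
    (forall n x, h n.+1 (f n x) = h n x) ->
  exists k : {additive dirlim f -> P}, forall n x, k (to_dirlim f x) = h n x.
Proof.
move=> hS; have [w w' r|k kE] := @presented_lift (lim_gen M) (lim_rel f) P
    (fun s => h (tag s) (tagged s)).
  case: r => [n|n x y|n x]; rewrite ?big_seq1.
  - by rewrite big_nil; apply: raddf0.
  - by rewrite big_cons big_seq1; apply: raddfD.
  - by rewrite [RHS]hS.
by exists k => n x; rewrite [LHS]kE.
Qed.

Lemma dirlim_ext (P : nmodType) (k k' : {additive dirlim f -> P}) :
  (forall n (x : M n), k (to_dirlim f x) = k' (to_dirlim f x)) -> k =1 k'.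
Proof. by move=> kk'; apply: presented_ext => -[n x]; apply: kk'. Qed.

End DirectLimit.

Lemma refinement_bij (M N N' : nmodType) (h : {additive M -> N})
    (psi : {additive N -> N'}) (nu : {additive M -> N'}) :
    bijective psi -> nu =1 psi \o h ->
  is_refinement h -> is_refinement nu.
Proof.
move=> [phi psiK phiK] nuE [conM conN [hI hC hU] refN univ].
have phiD : nmod_morphism phi.
  split=> [|x y]; first by rewrite -(raddf0 psi) psiK.
  by rewrite -{1}(phiK x) -{1}(phiK y) -raddfD psiK.
pose phiM := Algebra.isNmodMorphism.Build N' N phi phiD.
pose phia : {additive N' -> N} := HB.pack phi phiM.
split=> //.
- move=> a b ab; have [] : phi a = 0 /\ phi b = 0.
    by apply: conN; rewrite -[LHS](raddfD phia) ab (raddf0 phia).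
  by move=> a0 b0; rewrite -(phiK a) -(phiK b) a0 b0 raddf0.
- split.
  + move=> x y; rewrite !nuE /= => /(can_inj psiK); exact: hI.
  + move=> u; have [v [c uv]] := hC (phi u); exists v, (psi c).
    by rewrite nuE /= -uv raddfD phiK.
  + move=> u u' v; rewrite !nuE /= => uvu'.
    have [|w vw] := hU u u' (phi v); last by exists w; rewrite nuE /= -vw phiK.
    by apply: (can_inj psiK); rewrite raddfD phiK.
- move=> a b c d abcd.
  have [|x [y [z [t [ax bz cx dy]]]]] := refN (phi a) (phi b) (phi c) (phi d).
    by rewrite -![LHS](raddfD phia) abcd [LHS](raddfD phia).
  exists (psi x), (psi y), (psi z), (psi t).
  by rewrite -!raddfD -ax -bz -cx -dy !phiK.
- move=> P xi /univ -/(_ xi)[xit xitE].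
  exists (xit \o phia : {additive _ -> _}) => x.
  by rewrite nuE /= psiK.
Qed.

Theorem lemma4p5 (E : bipGraph) (finE : finite_sepGraph E) :
  exists (phi : forall n, {additive Mon (E_ E n.+1) -> Mon (multires (@V_ E n))})
         (iota : forall n, {additive Mon (E_ E n) -> Mon (E_ E n.+1)}),
  [/\ forall n, bijective (phi n) /\
        (forall v : vert (E_ E n.+1),
           exists2 w, same_vertex v w & phi n (agen v) = agen w),
      forall n, induced_by (inl : vert (E_ E n) -> vert (multires (@V_ E n)))
                  (fun x => phi n (iota n x)) /\
        unitary_embedding (iota n),
      forall n, exists2 psi : {additive Mon (E_ E n) -> Mon (F_ E n)},
        induced_by (fun v : vert (E_ E n) => val v) psi & bijective psi,
      exists Psi : {additive Mon (Finf E) -> dirlim iota}, bijective Psi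
    & exists2 nu : {additive Mon E -> dirlim iota},
        (forall v : vert E, exists2 w : vert (E_ E 0),
           val w = v & nu (agen v) = to_dirlim iota (agen w))
        & is_refinement nu].
Proof.
have full n : full_stage (F_ E n) := full_F finE n.
have rho_ex n :
    exists rho : {additive Mon (F_ E n) -> Mon (E_ E n)}, top_retract rho.
  elim: n => [|n [rho rhoP]]; first exact: retract_stage0.
  exact: (retract_next (full n) (@canon_ends E n.+1) rhoP).
pose rho n := projT1 (cid (rho_ex n)).
have rhoP n : top_retract (rho n) by rewrite /rho; case: cid.
pose kappa n := projT1 (cid (top_incl_ex (full n) (@canon_ends E n))).
have kappaE n : top_incl (kappa n) by rewrite /kappa; case: cid.
have kappaK n : cancel (kappa n) (rho n) := top_retractK (@kappaE n) (rhoP n).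
have rhoK n : cancel (rho n) (kappa n) := (rhoP n).2 _ (@kappaE n).
pose j n := projT1 (cid (stage_incl_ex finE n)).
have jE n v : j n (agen v) = agen (inl v : vert (F_ E n.+1)).
  exact: (projT2 (cid (stage_incl_ex finE n)) v).
pose theta n := projT1 (cid (multires_top (full n) (rhoP n))).
have thetaP n : [/\ bijective (theta n),
    forall v : vert (E_ E n), theta n (agen (inl (val v) : vert (F_ E n.+1))) =
      agen (inl v : vert (multires (@V_ E n)))
  & forall q : newVert (@lay0 (F_ E n)), exists p : newVert (@V_ E n),
      [/\ base q = val (base p), tup q = val @` tup p
        & theta n (agen (inr q : vert (F_ E n.+1))) =
          agen (inr p : vert (multires (@V_ E n)))]].
  exact: projT2 (cid (multires_top (full n) (rhoP n))).
pose phi n : {additive Mon (E_ E n.+1) -> Mon (multires (@V_ E n))} :=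
  theta n \o kappa n.+1.
pose iota n : {additive Mon (E_ E n) -> Mon (E_ E n.+1)} :=
  rho n.+1 \o (j n \o kappa n).
have kappa_bij n : bijective (kappa n) by exists (rho n).
have rho_bij n : bijective (rho n) := Bijective (rhoK n) (@kappaK n).
pose t n : {additive Mon (F_ E n) -> dirlim iota} :=
  @to_dirlim _ iota n \o rho n.
have [n v|Psi PsiE] := @Finf_lift E finE _ t.
  by rewrite -jE -[X in j n X]rhoK; apply: (@to_dirlimS _ iota n).
pose k n := projT1 (cid (Finf_incl_ex E n)).
have kE n v : k n (agen v) = agen (to_vert v : vert (Finf E)).
  by rewrite /k; case: cid.
have PsiK n : Psi \o k n =1 t n.
  by apply: (Mon_ext (h := Psi \o k n)) => v /=; rewrite kE PsiE.
have Psi_bij : bijective Psi.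
  have kS n : k n.+1 \o j n =1 k n.
    by apply: (Mon_ext (h := k n.+1 \o j n)) => v /=; rewrite jE !kE.
  have [n x|Psi' Psi'E] := @dirlim_lift _ iota _
      (fun n => k n \o kappa n : {additive _ -> _}).
    by rewrite /= rhoK -[LHS]/((k n.+1 \o j n) _) kS.
  exists Psi'.
    apply: (Mon_ext (h := Psi' \o Psi) (h' := idfun)) => v /=.
    have [n [w <-]] : exists n (w : vert (F_ E n)), to_vert w = v.
      by case: v => [v|[n p]]; [exists 0%N, v|exists n.+1, (inr p)].
    by rewrite PsiE /= Psi'E /= rhoK kE.
  apply: (dirlim_ext (k := Psi \o Psi') (k' := idfun)) => n x /=.
  by rewrite Psi'E -[LHS]/((Psi \o k n) _) PsiK /= kappaK.
exists phi, iota; split.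
- move=> n; have [theta_bij thetal thetar] := thetaP n; split.
    exact: (bij_comp theta_bij (kappa_bij n.+1)).
  move=> v; have -> : phi n (agen v) = theta n (agen (val v)).
    by rewrite /= kappaE.
  have := valP v; rewrite /same_vertex.
  case: (val v) => [a|q].
    move=> /asboolP[[b lb [ba]]|[q _ //]]; rewrite {}ba in lb.
    have [w wa] := rs_vert_ex (@canon_ends E n) (or_intror lb).
    by exists (inl w); rewrite -wa // -thetal.
  move=> _; have [p [bp tp pE]] := thetar q.
  by exists (inr p).
- move=> n; have [theta_bij thetal thetar] := thetaP n; split.
    by move=> v; rewrite /= rhoK kappaE jE thetal.
  apply: (unitary_comp (g := rho n.+1)); last exact: (unitary_bij (rho_bij n.+1)).
  apply: (unitary_comp (g := j n)); first exact: (unitary_bij (kappa_bij n)).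
  exact: (stage_incl_unitary finE (@jE n)).
- by move=> n; exists (kappa n); [apply: kappaE|apply: kappa_bij].
- by exists Psi.
exists (t 0%N).
  move=> v; have Pv : (@lay0 (F_ E 0) `|` @lay1 (F_ E 0)) v.
    by rewrite [_ `|` _](@bip_cover E).
  have [w wv] := rs_vert_ex (@canon_ends E 0) Pv; exists w => //.
  by rewrite -wv; have [rhoE _] := rhoP 0%N; rewrite /= rhoE.
apply: (refinement_bij Psi_bij (h := k 0%N)) => [x|]; first by rewrite PsiK.
split.
- exact: Mon_conical.
- exact: Mon_conical.
- exact: (Finf_unitary finE (@kE 0%N)).
- exact: Finf_refinement.
move=> P psi refP; have [g gE] := Finf_universal finE psi refP.
exists g; apply: (Mon_ext (h := psi) (h' := g \o k 0%N)) => v /=.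
by rewrite kE gE.
Qed.
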